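(* Assume (H1)–(H4) and (U) (for given $x_0$, $r$, $\theta$). Let $u\in C(\mathbb{R}^n\times[0,T))$ be a viscosity solution of (1.1)–(1.2). Then: (i) if $(C_1,K_3)\ne(0,0)$, $|p|\ge\theta e^{-(C_1+K_3)t}-\frac{C_1\beta}{C_1+K_3}(1-e^{-(C_1+K_3)t})$ for all $(x,t)\in\mathcal{E}(x_0,r)$ and $p\in D_x^-u(x,t)$; (ii) if $(C_1,K_3)=(0,0)$, $|p|\ge\theta$ for all $(x,t)\in\mathcal{E}(x_0,r)$ and $p\in D_x^-u(x,t)$.
   Context: Let $T>0$, $n\ge1$. $H:\mathbb{R}^n\times[0,T]\times\mathbb{R}\times\mathbb{R}^n\to\mathbb{R}$ continuous, $u_0$ Lipschitz. Problem (1.1)–(1.2): $u_t+H(x,t,u,D_xu)=0$ in $\mathbb{R}^n\times(0,T)$, $u(x,0)=u_0(x)$. (H1) there exist $C_1\ge0$, $\beta\in\{0,1\}$ with $|H(x,t,u,p)-H(y,t,u,p)|\le C_1(\beta+|p|)|x-y|$. (H2) there exist $A_2,B_2\ge0$ with $|H(x,t,u,p)-H(x,t,u,q)|\le(A_2|x|+B_2)|p-q|$. (H3) there exists $K_3\ge0$ with $|H(x,t,u,p)-H(x,t,v,p)|\le K_3|u-v|$. (H4) $p\mapsto H(x,t,u,p)$ convex. (U) for the given $x_0$, $r>0$ there is $\theta>0$ with $|p|\ge\theta$ for all $x\in B_r(x_0)$, $p\in D^-u_0(x)$. Viscosity solution: $u\in C(\mathbb{R}^n\times[0,T))$, $u(\cdot,0)=u_0$,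 and for every $\phi\in C^1(\mathbb{R}^n\times(0,T))$, if $u-\phi$ has a local max (resp. min) at $(x,t)\in\mathbb{R}^n\times(0,T)$ then $\phi_t+H(x,t,u(x,t),D_x\phi(x,t))\le0$ (resp. $\ge0$). $D^-f(x)=\{D\phi(x):\phi\in C^1,\ f-\phi$ has a local min at $x\}$; $D_x^-u(x,t)=\{p:(p,\tau)\in D^-u(x,t)\}$. $R(x,t)=(\frac{B_2}{A_2}+|x|)(e^{A_2t}-1)$ if $A_2>0$, $=B_2t$ if $A_2=0$; $\mathcal{E}(x_0,r)=\{(x,t)\in B_r(x_0)\times(0,T):R(x,t)+|x-x_0|<r\}$. *)

(* Defs.v *)
From HB Require Import structures.
From mathcomp Require Import all_boot all_order all_algebra.
From mathcomp Require Import all_classical all_reals all_analysis.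
Set Implicit Arguments. Unset Strict Implicit. Unset Printing Implicit Defensive.
Import Order.TTheory GRing.Theory Num.Theory.
Local Open Scope ring_scope.

Definition dotv {R : realType} {n : nat} (p q : 'rV[R]_n) : R :=
  \sum_(i < n) p ord0 i * q ord0 i.
Definition enorm {R : realType} {n : nat} (p : 'rV[R]_n) : R :=
  Num.sqrt (dotv p p).

Definition cont_on_strip {R : realType} {n : nat} (T : R)
  (u : 'rV[R]_n -> R -> R) : Prop :=
  forall x t, 0 <= t < T -> forall e : R, 0 < e -> exists2 d : R, 0 < d &
    forall y s, 0 <= s < T -> enorm (y - x) < d -> `|s - t| < d ->
      `|u y s - u x t| < e.

Definition C1_strip {R : realType} {n : nat} (T : R)
  (phi : 'rV[R]_n -> R -> R) (Dx : 'rV[R]_n -> R -> 'rV[R]_n)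
  (Dt : 'rV[R]_n -> R -> R) : Prop :=
  forall x t, 0 < t < T -> forall e : R, 0 < e -> exists2 d : R, 0 < d &
    forall y s, 0 < s < T -> enorm (y - x) < d -> `|s - t| < d ->
      [/\ `|phi y s - phi x t - dotv (Dx x t) (y - x) - Dt x t * (s - t)|
            <= e * (enorm (y - x) + `|s - t|),
          enorm (Dx y s - Dx x t) < e &
          `|Dt y s - Dt x t| < e].

Definition C1_space {R : realType} {n : nat}
  (phi : 'rV[R]_n -> R) (Dphi : 'rV[R]_n -> 'rV[R]_n) : Prop :=
  forall x, forall e : R, 0 < e -> exists2 d : R, 0 < d &
    forall y, enorm (y - x) < d ->
      `|phi y - phi x - dotv (Dphi x) (y - x)| <= e * enorm (y - x) /\
      enorm (Dphi y - Dphi x) < e.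

Definition loc_max_strip {R : realType} {n : nat} (T : R)
  (f : 'rV[R]_n -> R -> R) (x : 'rV[R]_n) (t : R) : Prop :=
  exists2 d : R, 0 < d & forall y s, 0 < s < T -> enorm (y - x) < d ->
    `|s - t| < d -> f y s <= f x t.
Definition loc_min_strip {R : realType} {n : nat} (T : R)
  (f : 'rV[R]_n -> R -> R) (x : 'rV[R]_n) (t : R) : Prop :=
  exists2 d : R, 0 < d & forall y s, 0 < s < T -> enorm (y - x) < d ->
    `|s - t| < d -> f x t <= f y s.

Definition subdiff {R : realType} {n : nat} (f : 'rV[R]_n -> R)
  (x p : 'rV[R]_n) : Prop :=
  exists phi Dphi, C1_space phi Dphi /\ p = Dphi x /\
    exists2 d : R, 0 < d & forall y, enorm (y - x) < d ->
      f x - phi x <= f y - phi y.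

Definition subdiff_x {R : realType} {n : nat} (T : R)
  (u : 'rV[R]_n -> R -> R) (x : 'rV[R]_n) (t : R) (p : 'rV[R]_n) : Prop :=
  exists tau : R, exists phi Dx Dt, C1_strip T phi Dx Dt /\
    p = Dx x t /\ tau = Dt x t /\
    loc_min_strip T (fun y s => u y s - phi y s) x t.

Definition visc_sol {R : realType} {n : nat} (T : R)
  (H : 'rV[R]_n -> R -> R -> 'rV[R]_n -> R) (u0 : 'rV[R]_n -> R)
  (u : 'rV[R]_n -> R -> R) : Prop :=
  [/\ cont_on_strip T u,
      (forall x, u x 0 = u0 x) &
      forall phi Dx Dt, C1_strip T phi Dx Dt -> forall x t, 0 < t < T ->
        (loc_max_strip T (fun y s => u y s - phi y s) x t ->
           Dt x t + H x t (u x t) (Dx x t) <= 0) /\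
        (loc_min_strip T (fun y s => u y s - phi y s) x t ->
           Dt x t + H x t (u x t) (Dx x t) >= 0)].

Definition H_cont {R : realType} {n : nat} (T : R)
  (H : 'rV[R]_n -> R -> R -> 'rV[R]_n -> R) : Prop :=
  forall x t v p, 0 <= t <= T -> forall e : R, 0 < e -> exists2 d : R, 0 < d &
    forall y s w q, 0 <= s <= T -> enorm (y - x) < d -> `|s - t| < d ->
      `|w - v| < d -> enorm (q - p) < d ->
      `|H y s w q - H x t v p| < e.

Definition lipschitz_fun {R : realType} {n : nat} (f : 'rV[R]_n -> R) : Prop :=
  exists L : R, forall x y, `|f x - f y| <= L * enorm (x - y).

Definition Rfun {R : realType} {n : nat} (A2 B2 : R) (x : 'rV[R]_n) (t : R) : R :=
  if 0 < A2 then (B2 / A2 + enorm x) * (expR (A2 * t) - 1) else B2 * t.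

Definition Eset {R : realType} {n : nat} (T A2 B2 : R) (x0 : 'rV[R]_n) (r : R)
  (x : 'rV[R]_n) (t : R) : Prop :=
  enorm (x - x0) < r /\ 0 < t < T /\ Rfun A2 B2 x t + enorm (x - x0) < r.

(* Main.v *)
Require Import Defs.
From HB Require Import structures.
From mathcomp Require Import all_boot all_order all_algebra.
From mathcomp Require Import all_classical all_reals all_analysis.
From mathcomp Require Import ring lra.
Import Order.TTheory GRing.Theory Num.Theory.
Import numFieldNormedType.Exports.
Local Open Scope classical_set_scope.
Local Open Scope ring_scope.
Set Implicit Arguments.
Unset Strict Implicit.
Unset Printing Implicit Defensive.

(** Write [rho(t) = rho0 exp(C1 t)] and [v(x,t) = min { u(y,t) : |y - x| <= rho(t) }]. If [v] is
    touched from below at [x] by a function of gradient [p], then [p] points from the minimizer to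
    [x], so that the growth of the ball contributes [rho' |p| = C1 rho |p|], which absorbs the
    [|p|]-part of the error that (H1) makes in moving the equation of [u] from the minimizer to [x]:
    [v] satisfies the equation up to [C1 beta rho]. This needs the subsolution inequality of
    [u] at points of [D^- u], which is the Barron-Jensen theorem for convex Hamiltonians; the
    converse, from [D^- v] back to [D^+ v], is the same theorem applied to [- v(x, T - t)].
    The condition (U) gives [v(x,0) <= u0(x) - theta rho0]. Comparison in the backward cone of
    [(x,t)] with [g' = - K3 g - C1 beta rho], [g(0) = theta rho0], gives [v + g <= u] at [(x,t)],
    and [g / rho] is the claimed bound; letting [rho0 -> 0] bounds the slope [|p|] of any
    subgradient.

    Barron-Jensen is proved without a.e. differentiability: if [u] is touched from below
    with gradient [p], a sup-convolution of [u] is followed along an Euler scheme whose direction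
    is [(q, 1)], with [q] an approximate subgradient of [H(x,t,u,.)] at [p]. *)

(** * The Euclidean norm *)

(** A pointwise gradient bound does not pass through viscosity inequalities, but a drop does: if [u]
    falls by at least [rho b] within every small ball of radius [rho], then its subgradients have
    length at least [b], and the minimum over balls measures this drop. Moving a contact point to a
    minimizer works only for functions touching [v] from below, whereas comparison with the
    supersolution [u] meets functions touching [v] from above; this mismatch is the obstacle that
    makes convexity enter twice. The two uses fit together because the hypothesis on the function is
    tested on positive quadratics alone, the penalties of sup-convolutions, while the conclusion
    holds for every first-order subgradient. The quotient [b = g / rho] solves
    [b' = - (C1 + K3) b - C1 beta], whose equilibrium is [- C1 beta / (C1 + K3)]: this is the origin
    of the constants in the bound. *)

Lemma dotvC (R : realType) n (p q : 'rV[R]_n) : dotv p q = dotv q p.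
Proof. by apply: eq_bigr => i _; rewrite mulrC. Qed.

Lemma dotvDl (R : realType) n (p q s : 'rV[R]_n) :
  dotv (p + q) s = dotv p s + dotv q s.
Proof. by rewrite -big_split; apply: eq_bigr => i _; rewrite mxE mulrDl. Qed.

Lemma dotvDr (R : realType) n (s p q : 'rV[R]_n) :
  dotv s (p + q) = dotv s p + dotv s q.
Proof. by rewrite dotvC dotvDl !(dotvC s). Qed.

Lemma dotvZl (R : realType) n (c : R) (p q : 'rV[R]_n) :
  dotv (c *: p) q = c * dotv p q.
Proof. by rewrite mulr_sumr; apply: eq_bigr => i _; rewrite mxE mulrA. Qed.

Lemma dotvZr (R : realType) n (c : R) (p q : 'rV[R]_n) :
  dotv p (c *: q) = c * dotv p q.
Proof. by rewrite dotvC dotvZl dotvC. Qed.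

Lemma dotvNl (R : realType) n (p q : 'rV[R]_n) : dotv (- p) q = - dotv p q.
Proof. by rewrite -scaleN1r dotvZl mulN1r. Qed.

Lemma dotvNr (R : realType) n (p q : 'rV[R]_n) : dotv p (- q) = - dotv p q.
Proof. by rewrite dotvC dotvNl dotvC. Qed.

Lemma dotv0l (R : realType) n (p : 'rV[R]_n) : dotv 0 p = 0.
Proof. by rewrite -(scale0r 0) dotvZl mul0r. Qed.

Lemma dotv0r (R : realType) n (p : 'rV[R]_n) : dotv p 0 = 0.
Proof. by rewrite dotvC dotv0l. Qed.

Definition dotvE := (dotvDl, dotvDr, dotvZl, dotvZr, dotvNl, dotvNr).

Lemma dotvv_ge0 (R : realType) n (p : 'rV[R]_n) : 0 <= dotv p p.
Proof. by apply: sumr_ge0 => i _; rewrite -expr2 sqr_ge0. Qed.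

Lemma enorm_ge0 (R : realType) n (p : 'rV[R]_n) : 0 <= enorm p.
Proof. exact: sqrtr_ge0. Qed.
#[local] Hint Extern 0 (is_true (0 <= enorm _)) => exact: enorm_ge0 : core.

Lemma sqr_enorm (R : realType) n (p : 'rV[R]_n) : enorm p ^+ 2 = dotv p p.
Proof. by rewrite sqr_sqrtr // dotvv_ge0. Qed.

Lemma enorm0 (R : realType) n : enorm (0 : 'rV[R]_n) = 0.
Proof. by rewrite /enorm dotv0l sqrtr0. Qed.

Lemma enormZ (R : realType) n (c : R) (p : 'rV[R]_n) :
  enorm (c *: p) = `|c| * enorm p.
Proof. by rewrite /enorm dotvZl dotvZr mulrA -expr2 sqrtrM ?sqr_ge0 // sqrtr_sqr. Qed.

Lemma enormN (R : realType) n (p : 'rV[R]_n) : enorm (- p) = enorm p.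
Proof. by rewrite -scaleN1r enormZ normrN1 mul1r. Qed.

Lemma enorm_subC (R : realType) n (p q : 'rV[R]_n) : enorm (p - q) = enorm (q - p).
Proof. by rewrite -enormN opprB. Qed.

Lemma enorm_eq0 (R : realType) n (p : 'rV[R]_n) : enorm p = 0 -> p = 0.
Proof.
move=> p0; have := sqr_enorm p; rewrite p0 expr0n /= => /esym/eqP.
rewrite psumr_eq0 => [/allP h|i _]; last by rewrite -expr2 sqr_ge0.
apply/rowP => i; rewrite mxE.
by have := h i (mem_index_enum _); rewrite mulf_eq0 orbb => /eqP.
Qed.

Lemma dotv_le (R : realType) n (p q : 'rV[R]_n) : dotv p q <= enorm p * enorm q.
Proof.
have [q0|q0] := eqVneq (enorm q) 0.
  by rewrite (enorm_eq0 q0) dotv0r enorm0 mulr0.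
apply: (le_trans (ler_norm _)).
rewrite -(@ler_pXn2r _ 2) ?nnegrE ?mulr_ge0 // exprMn !sqr_enorm.
rewrite real_normK ?num_real //.
have c0 : 0 < dotv q q by rewrite -sqr_enorm exprn_even_gt0.
(* Expanding the square of [|q|^2] times the component of [p] orthogonal to [q] yields
   [|q|^2 (|p|^2 |q|^2 - (p.q)^2)]. *)
have := dotvv_ge0 (dotv q q *: p - dotv p q *: q).
rewrite !dotvE (dotvC q p).
set a := dotv p p; set b := dotv p q; set c := dotv q q in c0 *.
rewrite [leRHS](_ : _ = c * (a * c - b ^+ 2)); last by ring.
by rewrite pmulr_rge0 // subr_ge0.
Qed.

Lemma dotv_ge (R : realType) n (p q : 'rV[R]_n) : - (enorm p * enorm q) <= dotv p q.
Proof. by rewrite lerNl -dotvNl (le_trans (dotv_le _ _)) // enormN. Qed.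

Lemma dotv_norm_le (R : realType) n (p q : 'rV[R]_n) :
  `|dotv p q| <= enorm p * enorm q.
Proof. by rewrite ler_norml dotv_ge dotv_le. Qed.

Lemma enormD (R : realType) n (p q : 'rV[R]_n) : enorm (p + q) <= enorm p + enorm q.
Proof.
rewrite -(@ler_pXn2r _ 2) ?nnegrE ?addr_ge0 // sqrrD !sqr_enorm !dotvE (dotvC q p).
have := dotv_le p q; lra.
Qed.

Lemma enorm_dist (R : realType) n (x y z : 'rV[R]_n) :
  enorm (x - z) <= enorm (x - y) + enorm (y - z).
Proof. by apply: le_trans (enormD _ _); rewrite addrA subrK. Qed.

Lemma enorm_lip (R : realType) n (p q : 'rV[R]_n) : `|enorm p - enorm q| <= enorm (p - q).
Proof.
rewrite ler_norml; apply/andP; split.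
  have := enormD (q - p) p; rewrite subrK enorm_subC; lra.
have := enormD (p - q) q; rewrite subrK; lra.
Qed.

Lemma entry_le_enorm (R : realType) n (p : 'rV[R]_n) i : `|p ord0 i| <= enorm p.
Proof.
rewrite -(@ler_pXn2r _ 2) ?nnegrE // sqr_enorm real_normK ?num_real //.
rewrite /dotv (bigD1 i) //= -expr2 lerDl.
by apply: sumr_ge0 => j _; rewrite -expr2 sqr_ge0.
Qed.

Lemma enorm_le_entries (R : realType) n (p : 'rV[R]_n) (d : R) :
  0 <= d -> (forall i, `|p ord0 i| <= d) -> enorm p <= n%:R * d.
Proof.
move=> d0 hp; rewrite -(@ler_pXn2r _ 2) ?nnegrE ?mulr_ge0 ?ler0n // sqr_enorm.
apply: (@le_trans _ _ (\sum_(i < n) d ^+ 2)).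
  apply: ler_sum => i _; rewrite -expr2 -real_normK ?num_real //.
  by rewrite ler_pXn2r ?nnegrE.
rewrite sumr_const card_ord exprMn -[leLHS]mulr_natl ler_wpM2r ?sqr_ge0 //.
case: n {p hp} => [|n]; first by rewrite expr0n.
by rewrite -natrX ler_nat expnS expn1 leq_pmulr.
Qed.

(** * Compactness in space-time *)

Lemma mxnorm_le_enorm (R : realType) n (p : 'rV[R]_n) : `|p| <= enorm p.
Proof.
rewrite [leLHS]/Num.norm /= mx_normrE; apply/bigmax_leP; split=> // -[i j] _ /=.
by rewrite ord1 entry_le_enorm.
Qed.

Lemma enorm_le_mxnorm (R : realType) n (p : 'rV[R]_n) : enorm p <= n%:R * `|p|.
Proof.
apply: enorm_le_entries => // i.
rewrite [leRHS]/Num.norm /= mx_normrE; apply/bigmax_geP; right.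
by exists (ord0, i).
Qed.

Lemma enorm_continuous (R : realType) n : continuous (@enorm R n).
Proof.
move=> p; apply/(@cvgrPdist_lt _ R^o _ (nbhs p) (nbhs_filter p)) => e e0.
have d0 : 0 < e / n.+1%:R by rewrite divr_gt0 ?ltr0n.
apply/nbhs_ballP; exists (e / n.+1%:R) => //= q; rewrite -ball_normE /= => hq.
apply: (le_lt_trans (enorm_lip _ _)); apply: (le_lt_trans (enorm_le_mxnorm _)).
apply: (@le_lt_trans _ _ (n.+1%:R * `|p - q|)).
  by rewrite ler_wpM2r // ler_nat.
by rewrite mulrC -ltr_pdivlMr ?ltr0n.
Qed.

Lemma enorm_sub_cvg (R : realType) n (T : Type) (F : set_system T) (FF : Filter F)
  (f g : T -> 'rV[R]_n) (a b : 'rV[R]_n) :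
  f @ F --> a -> g @ F --> b -> (fun s => enorm (f s - g s)) @ F --> enorm (a - b).
Proof. by move=> fa gb; apply: (continuous_cvg _ (@enorm_continuous R n _)); apply: cvgB. Qed.

(** The definitions use Euclidean balls while the topology on row vectors comes from the max norm;
    this is the bridge to the neighbourhood filter of the product. *)
Lemma near_strip (R : realType) n (x : 'rV[R]_n) (t d : R) : 0 < d ->
  \forall Q \near (x, t), enorm (Q.1 - x) < d /\ `|Q.2 - t| < d.
Proof.
move=> d0; near=> Q; split; near: Q.
  have h : (fun Q : 'rV[R]_n * R => enorm (Q.1 - x)) @ nbhs (x, t) --> enorm (x - x).
    by apply: enorm_sub_cvg; [exact: cvg_fst | exact: cvg_cst].
  rewrite subrr enorm0 in h.
  by apply: (cvgr_lt 0 h); exact: d0.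
have h : (fun Q : 'rV[R]_n * R => `|Q.2 - t|) @ nbhs (x, t) --> `|t - t|.
  by apply: cvg_norm; apply: cvgB; [exact: cvg_snd | exact: cvg_cst].
rewrite subrr normr0 in h.
by apply: (cvgr_lt 0 h); exact: d0.
Unshelve. all: by end_near. Qed.

Lemma cvg_within_strip (R : realType) n (K : set ('rV[R]_n * R))
  (f : 'rV[R]_n -> R -> R) x t :
  (forall e, 0 < e -> exists2 d, 0 < d & forall y s, K (y, s) ->
     enorm (y - x) < d -> `|s - t| < d -> `|f y s - f x t| < e) ->
  (fun Q => f Q.1 Q.2) @ within K (nbhs (x, t)) --> f x t.
Proof.
move=> h; apply/cvgrPdist_lt => e e0; have [d d0 hd] := h e e0.
rewrite near_withinE.
by apply: filterS (near_strip x t d0) => -[y s] [h1 h2] KQ; rewrite distrC; exact: hd.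
Qed.

Lemma compact_max (R : realType) (X : topologicalType) (K : set X) (f : X -> R) a :
  compact K -> K a -> (forall x, K x -> f @ within K (nbhs x) --> f x) ->
  exists2 c, K c & forall x, K x -> f x <= f c.
Proof.
move=> cK Ka cf.
have [|c /set_mem Kc hc] := @compact_EVT_max X R f K (ex_intro _ a Ka) cK.
  by apply/subspace_continuousP.
by exists c => // x Kx; apply/hc/mem_set.
Qed.

Lemma compact_min (R : realType) (X : topologicalType) (K : set X) (f : X -> R) a :
  compact K -> K a -> (forall x, K x -> f @ within K (nbhs x) --> f x) ->
  exists2 c, K c & forall x, K x -> f c <= f x.
Proof.
move=> cK Ka cf; have [|c Kc hc] := @compact_max R X K (fun x => - f x) a cK Ka.
  by move=> x Kx; apply: cvgN; exact: cf.
by exists c => // x Kx; rewrite -lerN2; exact: hc.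
Qed.

(** Near-covering compactness: each point of [K] has a neighbourhood on which all small [d] work,
    and this passes to the whole of [K] at once. *)
Lemma heine_cantor (R : realType) (X : pseudoMetricType R) (K : set X) (f : X -> R) :
  compact K -> (forall x, K x -> f @ within K (nbhs x) --> f x) ->
  forall e, 0 < e -> exists2 d, 0 < d &
    forall x y, K x -> K y -> ball x d y -> `|f x - f y| < e.
Proof.
move=> /compact_near_coveringP cK cf e e0.
have e2 : 0 < e / 2 by lra.
pose P (d : R) x := K x -> forall y, K y -> ball x d y -> `|f x - f y| < e.
have : \forall d \near 0^'+, K `<=` P d.
  apply: cK => x Kx.
  have /cvgrPdist_lt/(_ _ e2) := cf x Kx.
  rewrite near_withinE => /nbhs_ballP[r /= r0 hr].
  have r2 : 0 < r / 2 by lra.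
  exists (ball x (r / 2), [set d : R | d < r / 2]) => /=.
    split; first exact: nbhsx_ballx.
    by apply: nbhs_right_lt; lra.
  move=> [x' d] [/= xx' dr] Kx' y Ky x'y.
  have h1 : `|f x - f x'| < e / 2.
    by apply: hr => //; apply: le_ball xx'; lra.
  have h2 : `|f x - f y| < e / 2.
    apply: hr => //; rewrite [r]splitr; apply: ball_triangle xx' _.
    by apply: le_ball x'y; lra.
  rewrite (_ : f x' - f y = (f x - f y) - (f x - f x')); last by ring.
  by apply: (le_lt_trans (ler_normB _ _)); lra.
move=> h; near (0 : R)^'+ => d; exists d => //.
move=> x y Kx Ky; have hd : K `<=` P d by near: d.
exact: hd.
Unshelve. all: by end_near. Qed.

Lemma enorm_ball_compact (R : realType) n (a : 'rV[R]_n) (r : R) :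
  compact [set y | enorm (y - a) <= r].
Proof.
apply: bounded_closed_compact.
  exists (`|a| + r); split; first by rewrite num_real.
  move=> M hM y /= hy; rewrite -(subrK a y); apply: (le_trans (ler_normD _ _)).
  by have := mxnorm_le_enorm (y - a); lra.
rewrite (_ : mkset _ = (fun y => enorm (y - a)) @^-1` [set s | s <= r]) //.
apply: closed_comp; last exact: closed_le.
by move=> y _; apply: (@enorm_sub_cvg R n _ (nbhs y) (nbhs_filter y) id (cst a));
  [exact: cvg_id | exact: cvg_cst].
Qed.

Definition cyl {R : realType} {n : nat} (a : 'rV[R]_n) (r b c : R) :
  set ('rV[R]_n * R) := [set Q | enorm (Q.1 - a) <= r /\ b <= Q.2 <= c].

Lemma cyl_compact (R : realType) n (a : 'rV[R]_n) (r b c : R) : compact (cyl a r b c).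
Proof.
rewrite (_ : cyl a r b c = [set y | enorm (y - a) <= r] `*` `[b, c]%classic).
  by apply: compact_setX; [exact: enorm_ball_compact | exact: segment_compact].
by apply/seteqP; split=> -[y s] /=; rewrite in_itv.
Qed.

Definition cts_on {R : realType} {n : nat} (K : set ('rV[R]_n * R))
    (f : 'rV[R]_n -> R -> R) : Prop :=
  forall x t, K (x, t) -> forall e, 0 < e -> exists2 d, 0 < d & forall y s, K (y, s) ->
     enorm (y - x) < d -> `|s - t| < d -> `|f y s - f x t| < e.

Lemma cts_on_cvg {R : realType} {n : nat} (K : set ('rV[R]_n * R))
    (f : 'rV[R]_n -> R -> R) : cts_on K f ->
  forall Q, K Q -> (fun Q => f Q.1 Q.2) @ within K (nbhs Q) --> f Q.1 Q.2.
Proof. by move=> cf [x t] KQ; apply: cvg_within_strip; exact: cf. Qed.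

Lemma unif_cts_on {R : realType} {n : nat} (K : set ('rV[R]_n * R))
    (f : 'rV[R]_n -> R -> R) : compact K -> cts_on K f ->
  forall e, 0 < e -> exists2 d, 0 < d & forall x t y s, K (x, t) -> K (y, s) ->
     enorm (y - x) < d -> `|s - t| < d -> `|f y s - f x t| < e.
Proof.
move=> cK cf e e0.
have [d d0 hd] := heine_cantor cK (cts_on_cvg cf) e0.
exists d => // x t y s Kx Ky h1 h2; apply: (hd (y, s) (x, t)) => //.
split=> /=; last exact: h2.
rewrite -ball_normE /=; exact: le_lt_trans (mxnorm_le_enorm _) h1.
Qed.

Lemma enorm_continuity (R : realType) n (f : 'rV[R]_n -> R) :
  (forall (x : 'rV[R]_n) (e : R), 0 < e -> exists2 d : R, 0 < d & forall y,
     enorm (y - x) < d -> `|f y - f x| < e) ->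
  continuous f.
Proof.
move=> h x; apply/(@cvgrPdist_lt _ R^o _ (nbhs x) (nbhs_filter x)) => e e0.
have [d d0 hd] := h x e e0.
have hc : (fun y => enorm (y - x)) @ nbhs x --> enorm (x - x).
  by apply: (@enorm_sub_cvg R n _ (nbhs x) (nbhs_filter x) id (cst x));
    [exact: cvg_id | exact: cvg_cst].
rewrite subrr enorm0 in hc.
have hn := @cvgr_lt _ _ (nbhs x) (nbhs_filter x) _ 0 hc d d0.
apply: (@filterS _ _ (nbhs_filter x) _ _ _ hn) => y hy; rewrite distrC; exact: hd.
Qed.

Lemma lipschitz_continuous (R : realType) n (f : 'rV[R]_n -> R) (L : R) :
  (forall p q, `|f p - f q| <= L * enorm (p - q)) -> continuous f.
Proof.
move=> hlip; apply: enorm_continuity => x e e0.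
have L1 : 0 < `|L| + 1 by rewrite ltr_wpDl.
exists (e / (`|L| + 1)) => [|y]; first by rewrite divr_gt0.
rewrite ltr_pdivlMr // => hy; apply: (le_lt_trans (hlip _ _)).
apply: le_lt_trans hy; rewrite mulrC ler_wpM2l //.
by have := ler_norm L; lra.
Qed.

(* The subgradient at the minimizer of [h + lam * |. - p|^2], a Moreau-Yosida point. *)
Lemma approx_subgradient (R : realType) n (h : 'rV[R]_n -> R) (L : R) :
  0 <= L -> (forall p q, `|h p - h q| <= L * enorm (p - q)) ->
  (forall p q l, 0 <= l <= 1 -> h (l *: p + (1 - l) *: q) <= l * h p + (1 - l) * h q) ->
  forall p eta, 0 < eta -> exists q, enorm q <= L /\
    forall p', h p + dotv q (p' - p) - eta <= h p'.
Proof.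
move=> L0 hlip hconv p eta eta0.
(* [L + 1 <= lam] keeps [F] at or above [F p] outside the unit ball, so the minimum found there is
   global; [L ^+ 2 <= lam * eta] bounds by [eta] the price of moving the base point from [m] back to
   [p]. *)
pose lam := L + 1 + L ^+ 2 / eta.
have L2 : 0 <= L ^+ 2 / eta by rewrite divr_ge0 ?sqr_ge0 // ltW.
have lam1 : L + 1 <= lam by rewrite /lam; lra.
have lam0 : 0 < lam by lra.
have lameta : L ^+ 2 <= lam * eta.
  rewrite /lam mulrDl divfK ?gt_eqF //; nra.
pose F p' := h p' + lam * enorm (p' - p) ^+ 2.
have ch : continuous h := lipschitz_continuous hlip.
have cn : continuous (fun y : 'rV[R]_n => enorm (y - p)).
  move=> x; apply: (@enorm_sub_cvg R n _ (nbhs x) (nbhs_filter x) id (cst p)).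
    exact: cvg_id.
  exact: cvg_cst.
have cF : continuous F.
  by move=> x; exact: (cvgD (ch x) (cvgM (cvg_cst lam) (cvgM (cn x) (cn x)))).
have Bp : [set y | enorm (y - p) <= 1] p by rewrite /= subrr enorm0.
have [|m /= m1 hm] := compact_min (@enorm_ball_compact R n p 1) Bp (f := F).
  by move=> x _; apply: cvg_within_filter; exact: cF.
have {m1}hm p' : F m <= F p'.
  have [h1|h1] := leP (enorm (p' - p)) 1; first exact: hm.
  apply: (@le_trans _ _ (F p)); first by apply: hm; rewrite /= subrr enorm0.
  rewrite /F subrr enorm0 expr0n mulr0 addr0.
  have := hlip p p'; rewrite enorm_subC ler_norml => /andP[_].
  have h2 : 0 <= lam * enorm (p' - p) - L by nra.
  by have := mulr_ge0 h2 (enorm_ge0 (p' - p)); lra.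
pose q := (2 * lam) *: (p - m).
have key p' : h m + dotv q (p' - m) <= h p'.
  rewrite leNgt; apply/negP => hlt.
  set gap := h m + dotv q (p' - m) - h p'.
  have gap0 : 0 < gap by rewrite /gap; lra.
  set W := enorm (p' - m) ^+ 2.
  have W0 : 0 <= W by rewrite sqr_ge0.
  (* Along the segment from [m] to [p'] convexity gains [s * gap], while the quadratic costs
     [s ^+ 2 * lam * W]; this [s] is at most [1] and makes the cost smaller than the gain, against
     minimality. *)
  pose s := gap / (gap + lam * W + lam * W).
  have den : 0 < gap + lam * W + lam * W by nra.
  have s0 : 0 < s by rewrite divr_gt0.
  have s1 : s <= 1 by rewrite ler_pdivrMr // mul1r; nra.
  have hs : s * (lam * W) < gap.
    by rewrite /s mulrAC ltr_pdivrMr // ltr_pM2l //; nra.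
  have := hm (s *: p' + (1 - s) *: m).
  have hcv : h (s *: p' + (1 - s) *: m) <= s * h p' + (1 - s) * h m.
    by apply: hconv; lra.
  have e1 : s *: p' + (1 - s) *: m - p = (m - p) + s *: (p' - m).
    by apply/rowP => i; rewrite !mxE; ring.
  rewrite /F e1 !sqr_enorm !dotvE; rewrite -/(dotv _ _).
  have W1 : W = dotv p' p' - 2 * dotv p' m + dotv m m.
    by rewrite /W sqr_enorm !dotvE (dotvC m p'); ring.
  have g1 : gap = h m + 2 * lam * (dotv p p' - dotv p m - dotv p' m + dotv m m) - h p'.
    by rewrite /gap /q !dotvE (dotvC m p'); ring.
  rewrite !(dotvC m) !(dotvC p' p).
  move: hs hcv; rewrite W1 => hs hcv hF.
  have : s * gap <= s * (s * (lam * (dotv p' p' - 2 * dotv p' m + dotv m m))).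
    by rewrite g1; lra.
  by rewrite ler_pM2l //; lra.
exists q; split.
  (* At [p' = m + q] the subgradient inequality and the Lipschitz bound give [|q|^2 <= L |q|]. *)
  have := key (m + q); rewrite [m + q]addrC addrK -sqr_enorm.
  have := hlip (q + m) m; rewrite addrK ler_norml => /andP[_] h1 h2.
  have h3 : enorm q ^+ 2 <= L * enorm q by lra.
  have := enorm_ge0 q; rewrite le_eqVlt => /orP[/eqP<- //|q0].
  by rewrite -(ler_pM2r q0) -expr2.
move=> p'; apply: le_trans (key p').
have -> : dotv q (p' - m) = dotv q (p' - p) + dotv q (p - m).
  by rewrite -dotvDr addrA subrK.
have -> : dotv q (p - m) = 2 * lam * enorm (p - m) ^+ 2 by rewrite dotvZl sqr_enorm.
have := hlip p m; rewrite ler_norml => /andP[_].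
have := enorm_ge0 (p - m); set d := enorm _ => d0 hd.
have hk : L * d <= lam * d ^+ 2 + eta.
  rewrite -(ler_pM2l lam0).
  have := sqr_ge0 (lam * d - L); have := mulr_ge0 (mulr_ge0 (ltW lam0) L0) d0.
  rewrite sqrrB exprMn; lra.
have := mulr_ge0 (ltW lam0) (sqr_ge0 d); lra.
Qed.

(** * Barron-Jensen theorem *)

(** Membership of [(p, tau)] in [D^- f(x, t)] through the first-order expansion, which avoids
    building a test function of class C^1. *)
Definition fsub {R : realType} {n : nat} (f : 'rV[R]_n -> R -> R) (x : 'rV[R]_n) (t : R)
    (p : 'rV[R]_n) (tau : R) : Prop :=
  forall e : R, 0 < e -> exists2 d : R, 0 < d & forall (y : 'rV[R]_n) (s : R),
    enorm (y - x) < d -> `|s - t| < d ->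
    f x t + dotv p (y - x) + tau * (s - t) - e * (enorm (y - x) + `|s - t|) <= f y s.

(** Space and time carry separate weights: [kx] bounds the momenta, these determine the modulus of
    [H] in time, and only then can [kt] be chosen. *)
Definition kquad {R : realType} {n : nat} (kx kt : R) (a : 'rV[R]_n) (b : R)
    (y : 'rV[R]_n) (s : R) : R :=
  kx * enorm (y - a) ^+ 2 + kt * (s - b) ^+ 2.

(** The subsolution property against positive quadratics only, the penalties of a sup-convolution.
    This much can also be verified for [- v] in reversed time. *)
Definition quadsub {R : realType} {n : nat} (T : R) (H : 'rV[R]_n -> R -> R -> 'rV[R]_n -> R)
    (u : 'rV[R]_n -> R -> R) : Prop :=
  forall (kx kt : R) (a : 'rV[R]_n) (b : R) (y : 'rV[R]_n) (s : R),
    0 < kx -> 0 < kt -> 0 < s < T ->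
    (exists2 d : R, 0 < d & forall (y' : 'rV[R]_n) (s' : R),
       enorm (y' - y) < d -> `|s' - s| < d ->
       u y' s' - kquad kx kt a b y' s' <= u y s - kquad kx kt a b y s) ->
    2 * kt * (s - b) + H y s (u y s) ((2 * kx) *: (y - a)) <= 0.

(** Bundled so that the same results apply to the given Hamiltonian and to its time reversal, with
    the same constants. *)
Record hamiltonian {R : realType} {n : nat} (T : R) (H : 'rV[R]_n -> R -> R -> 'rV[R]_n -> R)
    (C1 beta A2 B2 K3 : R) : Prop := Hamiltonian {
  ham_cont : H_cont T H;
  ham_C1 : 0 <= C1;
  ham_beta : 0 <= beta;
  ham_A2 : 0 <= A2;
  ham_B2 : 0 <= B2;
  ham_K3 : 0 <= K3;
  ham_x : forall x y t v p, 0 <= t <= T ->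
    `|H x t v p - H y t v p| <= C1 * (beta + enorm p) * enorm (x - y);
  ham_p : forall x t v p q, 0 <= t <= T ->
    `|H x t v p - H x t v q| <= (A2 * enorm x + B2) * enorm (p - q);
  ham_u : forall x t v w p, 0 <= t <= T -> `|H x t v p - H x t w p| <= K3 * `|v - w|;
  ham_conv : forall x t v p q (l : R), 0 <= t <= T -> 0 <= l <= 1 ->
    H x t v (l *: p + (1 - l) *: q) <= l * H x t v p + (1 - l) * H x t v q
}.

(** (H1)-(H3) give moduli of [H] in [x], [p] and [u] but none in [t]; on compact sets Heine-Cantor
    supplies one. *)
Lemma hamiltonian_unif_time (R : realType) n T (H : 'rV[R]_n -> R -> R -> 'rV[R]_n -> R)
    (a : 'rV[R]_n) (r b c M P : R) :
  H_cont T H -> 0 <= b -> c <= T -> forall e : R, 0 < e -> exists2 d : R, 0 < d &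
  forall y s t v p, enorm (y - a) <= r -> b <= s <= c -> b <= t <= c ->
    `|v| <= M -> enorm p <= P -> `|s - t| < d -> `|H y s v p - H y t v p| < e.
Proof.
move=> Hc b0 cT e e0.
(* The second cylinder holds the pair [(p, v)], with the momentum as space and the value as time. *)
pose K := cyl a r b c `*` cyl (0 : 'rV[R]_n) P (- M) M.
pose f := fun Q : ('rV[R]_n * R) * ('rV[R]_n * R) => H Q.1.1 Q.1.2 Q.2.2 Q.2.1.
have cK : compact K by apply: compact_setX; exact: cyl_compact.
have [Q [[_ hb] _]|d d0 hd] := @heine_cantor R _ K f cK _ e e0.
  apply/cvgrPdist_lt => e' e'0.
  have [|d d0 hd] := Hc Q.1.1 Q.1.2 Q.2.2 Q.2.1 _ e' e'0; first by lra.
  rewrite near_withinE.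
  have h1 : \forall S \near nbhs Q, enorm (S.1.1 - Q.1.1) < d /\ `|S.1.2 - Q.1.2| < d.
    case: Q hb hd => -[x t] w _ _.
    exact: (@cvg_fst _ _ (nbhs (x, t)) (nbhs w) _ _ (near_strip x t d0)).
  have h2 : \forall S \near nbhs Q, enorm (S.2.1 - Q.2.1) < d /\ `|S.2.2 - Q.2.2| < d.
    case: Q {h1} hb hd => w -[x t] _ _.
    exact: (@cvg_snd _ _ (nbhs w) (nbhs (x, t)) _ _ (near_strip x t d0)).
  apply: filterS2 h1 h2 => S [h1 h2] [h3 h4] [[_ hS] _].
  rewrite distrC; apply: hd => //; move: hS => /=; lra.
exists d => // y s t v p hy hs ht hv hp st.
apply: (hd ((y, s), (p, v)) ((y, t), (p, v))).
- by split; split; rewrite //= ?subr0 // -ler_norml.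
- by split; split; rewrite //= ?subr0 // -ler_norml.
- by split; [split; [exact: ballxx | exact: st] | exact: ballxx].
Qed.

Lemma kquad_continuous (R : realType) n kx kt (a : 'rV[R]_n) (b : R) :
  continuous (fun Q : 'rV[R]_n * R => kquad kx kt a b Q.1 Q.2).
Proof.
move=> Q.
have h1 : (fun Q : 'rV[R]_n * R => enorm (Q.1 - a)) @ nbhs Q --> enorm (Q.1 - a).
  by apply: enorm_sub_cvg; [exact: cvg_fst | exact: cvg_cst].
have h2 : (fun Q : 'rV[R]_n * R => Q.2 - b) @ nbhs Q --> Q.2 - b.
  by apply: cvgB; [exact: cvg_snd | exact: cvg_cst].
exact: (cvgD (cvgM (cvg_cst kx) (cvgM h1 h1)) (cvgM (cvg_cst kt) (cvgM h2 h2))).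
Qed.

Lemma kquad_max (R : realType) n (u : 'rV[R]_n -> R -> R) (a : 'rV[R]_n) r b c kx kt x t :
  0 <= r -> b <= c -> cts_on (cyl a r b c) u ->
  exists y s, cyl a r b c (y, s) /\ forall y' s', cyl a r b c (y', s') ->
    u y' s' - kquad kx kt x t y' s' <= u y s - kquad kx kt x t y s.
Proof.
move=> r0 bc cu.
have Ka : cyl a r b c (a, b) by rewrite /cyl /= subrr enorm0 lexx bc.
pose f := fun Q : 'rV[R]_n * R => u Q.1 Q.2 - kquad kx kt x t Q.1 Q.2.
have [|[y s] Ky hy] := compact_max (@cyl_compact R n a r b c) Ka (f := f).
  move=> Q KQ; apply: cvgB; first exact: cts_on_cvg.
  by apply: cvg_within_filter; exact: kquad_continuous.
by exists y, s; split=> // y' s' Ky'; exact: (hy (y', s')).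
Qed.

Lemma cts_onS (R : realType) n (K K' : set ('rV[R]_n * R)) u :
  K' `<=` K -> cts_on K u -> cts_on K' u.
Proof.
move=> KK' cu x t Kx e e0; have [d d0 hd] := cu x t (KK' _ Kx) e e0.
by exists d => // y s Ky; apply: hd; exact: KK'.
Qed.

Lemma kquad_ge0 (R : realType) n (kx kt : R) (a : 'rV[R]_n) b y s :
  0 <= kx -> 0 <= kt -> 0 <= kquad kx kt a b y s.
Proof. by move=> h1 h2; rewrite addr_ge0 // mulr_ge0 ?sqr_ge0. Qed.

Lemma kquad_lt (R : realType) n (kx kt : R) (a : 'rV[R]_n) b y s C r1 r2 :
  0 < kx -> 0 < kt -> 0 < r1 -> 0 < r2 -> C <= kx * r1 ^+ 2 -> C <= kt * r2 ^+ 2 ->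
  kquad kx kt a b y s < C -> enorm (y - a) < r1 /\ `|s - b| < r2.
Proof.
move=> kx0 kt0 r10 r20 h1 h2; rewrite /kquad => hk.
have p1 := mulr_ge0 (ltW kx0) (sqr_ge0 (enorm (y - a))).
have p2 := mulr_ge0 (ltW kt0) (sqr_ge0 (s - b)).
split; first rewrite -(@ltr_pXn2r _ 2) ?nnegrE ?(ltW r10) // -(ltr_pM2l kx0); first by lra.
rewrite -(@ltr_pXn2r _ 2) ?nnegrE ?(ltW r20) // real_normK ?num_real //.
by rewrite -(ltr_pM2l kt0); lra.
Qed.

(** Exact expansion of the penalty when its centre moves by [h (q, 1)]. The coefficient of [h] is
    the derivative of the penalty at [(y, s)] in the direction [(q, 1)], which the equation controls
    at a maximizer. *)
Lemma kquad_shift (R : realType) n (kx kt : R) (x q y : 'rV[R]_n) t s h :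
  kquad kx kt x t y s = kquad kx kt (x + h *: q) (t + h) y s +
    h * (dotv ((2 * kx) *: (y - (x + h *: q))) q + 2 * kt * (s - (t + h))) +
    h ^+ 2 * (kx * enorm q ^+ 2 + kt).
Proof.
have e : y - x = (y - (x + h *: q)) + h *: q by rewrite opprD addrA subrK.
rewrite /kquad e; move: (y - (x + h *: q)) => z.
rewrite !sqr_enorm !dotvE (dotvC q z); ring.
Qed.

Lemma exists_step (R : realType) (s d : R) : 0 < s -> 0 < d ->
  exists2 m : nat, (0 < m)%N & s / m%:R <= d.
Proof.
move=> s0 d0; exists (Num.truncn (s / d)).+1 => //.
rewrite ler_pdivrMr ?ltr0n // mulrC -ler_pdivrMr //.
exact/ltW/truncnS_gt.
Qed.

Lemma kquad_diag (R : realType) n (kx kt : R) (a : 'rV[R]_n) b : kquad kx kt a b a b = 0.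
Proof. by rewrite /kquad !subrr enorm0 !expr0n !mulr0 addr0. Qed.

(* One Euler step [(x, t) + h (q, 1)] along an approximate characteristic: the equation at the
   maximizer [(y, s)] bounds the growth of the sup-convolution. *)
Lemma barron_jensen_step (R : realType) n T (H : 'rV[R]_n -> R -> R -> 'rV[R]_n -> R)
    (C1 beta A2 B2 K3 : R) (HH : hamiltonian T H C1 beta A2 B2 K3)
    (uh us eta kx kt h r nu L P tauh : R) (x y q ph : 'rV[R]_n) (t s : R) :
  let x' := x + h *: q in let t' := t + h in let p := (2 * kx) *: (y - x') in
  0 < eta -> 0 < kx -> 0 < h -> 0 <= t <= T -> 0 <= s <= T ->
  (forall p', H x t uh ph + dotv q (p' - ph) - eta <= H x t uh p') ->
  enorm q <= L -> h * (kx * L ^+ 2 + kt) <= eta ->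
  enorm (y - x') <= r -> C1 * beta * r <= eta ->
  kx * enorm (y - x') ^+ 2 <= nu -> 2 * C1 * nu <= eta ->
  enorm p <= P -> C1 * (beta + P) * (h * L) <= eta ->
  K3 * `|us - uh| <= eta -> `|H y s uh p - H y t uh p| <= eta ->
  2 * kt * (s - t') + H y s us p <= 0 ->
  10 * eta <= tauh + H x t uh ph ->
  kquad kx kt x t y s - kquad kx kt x' t' y s <= h * (dotv ph q + tauh - 2 * eta).
Proof.
move=> x' t' p eta0 kx0 h0 tT sT hq qL hk yr rb kk nuC pP hC a1 a2 sub pos.
have C10 := ham_C1 HH; have be0 := ham_beta HH.
have hle : h ^+ 2 * (kx * enorm q ^+ 2 + kt) <= h * eta.
  rewrite expr2 -mulrA ler_pM2l //; apply: le_trans hk.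
  rewrite ler_pM2l // lerD2r ler_pM2l // ler_pXn2r ?nnegrE //.
  exact: le_trans (enorm_ge0 q) qL.
rewrite (kquad_shift kx kt x q y t s h) -/x' -/t' -/p.
(* Of the [10 eta], the estimates below spend six: one on the value, one on time, three on space,
   one on the subgradient. The [h ^+ 2] term costs one more, and [2 eta] must remain as the rate of
   loss. *)
suff : dotv p q + 2 * kt * (s - t') <= dotv ph q + tauh - 3 * eta.
  rewrite -(ler_pM2l h0) => hd; clear -hd hle; lra.
have {}a1 : `|H y s us p - H y s uh p| <= eta.
  by apply: le_trans a1; apply: (ham_u HH).
have yx : enorm (x - y) <= enorm (y - x') + h * L.
  have := enorm_dist y x' x; rewrite (enorm_subC x).
  have -> : enorm (x' - x) = h * enorm q by rewrite /x' addrC addKr enormZ gtr0_norm.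
  have : h * enorm q <= h * L by rewrite ler_pM2l.
  by clear; lra.
have a3 : `|H x t uh p - H y t uh p| <= 3 * eta.
  apply: (le_trans (ham_x HH _ _ _ _ tT)).
  apply: (@le_trans _ _ (C1 * (beta + enorm p) * (enorm (y - x') + h * L))).
    by rewrite ler_wpM2l // mulr_ge0 // addr_ge0.
  have b1 : C1 * beta * enorm (y - x') <= eta.
    by apply: le_trans rb; rewrite ler_wpM2l // mulr_ge0.
  (* [|p| |y - x'|] is twice the spatial penalty, hence at most [2 nu]: this tames the factor [|p|]
     in (H1) although [p] may grow with [kx]. *)
  have b2 : C1 * enorm p * enorm (y - x') <= eta.
    rewrite /p enormZ gtr0_norm ?mulr_gt0 //; apply: le_trans nuC.
    rewrite (_ : _ * _ * _ = 2 * C1 * (kx * enorm (y - x') ^+ 2)); last by ring.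
    by rewrite ler_wpM2l // mulr_ge0.
  have b3 : C1 * (beta + enorm p) * (h * L) <= eta.
    apply: le_trans hC; rewrite ler_wpM2r ?mulr_ge0 ?(ltW h0) //.
      exact: le_trans (enorm_ge0 q) qL.
    by rewrite ler_wpM2l // lerD2l.
  clear -b1 b2 b3; lra.
have := hq p; rewrite dotvDr dotvNr (dotvC q p) (dotvC q ph) => a4.
move: a1 a2 a3; rewrite !ler_norml => a1 a2 a3.
clear -a1 a2 a3 a4 sub pos eta0; lra.
Qed.

(** Along the scheme the maximum of [u - kquad] over [B] grows per step by at most
    [h (ph.q + tauh - 2 eta)], whereas contact from below makes [u] gain at least
    [ph.(x - xh) + (tauh - eta) sg] over the time [sg]. The difference [eta sg] exceeds the initial
    error [nu]. *)
Lemma barron_jensen_path (R : realType) n T (H : 'rV[R]_n -> R -> R -> 'rV[R]_n -> R)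
    (C1 beta A2 B2 K3 : R) (HH : hamiltonian T H C1 beta A2 B2 K3) (u : 'rV[R]_n -> R -> R)
    (xh ph : 'rV[R]_n) (th tauh eta e0 r L sg nu rho1 rho2 rho3 kx kt h : R) (m : nat) :
  let uh := u xh th in let B := cyl xh r (th - r) (th + r) in
  quadsub T H u -> cts_on B u ->
  0 < eta -> 0 < r -> 0 < th - r -> th + r < T -> C1 * beta * r <= eta ->
  0 <= L -> A2 * (enorm xh + r) + B2 <= L -> K3 * e0 <= eta ->
  (forall y s, B (y, s) -> `|u y s - uh| < e0) ->
  (forall y s, B (y, s) -> 10 * eta <= tauh + H y s uh ph) ->
  0 < sg -> sg <= r / 2 -> L * sg <= r / 2 -> 2 * C1 * nu <= eta -> nu < eta * sg ->
  (forall x, enorm (x - xh) <= L * sg ->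
     uh + dotv ph (x - xh) + tauh * sg - eta * sg <= u x (th + sg)) ->
  0 < rho1 -> rho1 <= r / 4 -> 0 < rho3 -> rho3 <= rho1 -> rho3 <= rho2 / 2 -> h <= rho2 / 2 ->
  (forall x t y s, B (x, t) -> B (y, s) -> enorm (y - x) < rho1 -> `|s - t| < rho1 ->
     `|u y s - u x t| < nu) ->
  0 < kx -> 0 < kt -> 2 * e0 <= kx * rho1 ^+ 2 -> 2 * e0 <= kt * rho3 ^+ 2 ->
  (forall y s t p, enorm (y - xh) <= r -> th - r <= s <= th + r -> th - r <= t <= th + r ->
     enorm p <= 2 * kx * r -> `|s - t| < rho2 -> `|H y s uh p - H y t uh p| < eta) ->
  0 < h -> m%:R * h = sg -> h * (kx * L ^+ 2 + kt) <= eta ->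
  C1 * (beta + 2 * kx * r) * (h * L) <= eta -> False.
Proof.
move=> uh B qs cuB eta0 r0 thr thT rb L0 AL Ke0 Bu BH sg0 sgr Lsgr nuC nus hf rho10 rho1r rho30
  rho31 rho32 hr2 hu kx0 kt0 hkx hkt hHt h0 mh hk hC.
have BT y s : B (y, s) -> 0 < s < T by case=> /= _; clear -thr thT; lra.
have inB x t : enorm (x - xh) <= r -> `|t - th| <= r -> B (x, t).
  by move=> h1; rewrite ler_norml => h2; split=> //=; clear -h2; lra.
(* A point whose penalised value is at least that of the centre lies close to it, as [u] varies by
   less than [2 e0] on the cylinder. Maximizers are therefore interior, where [quadsub] applies. *)
have loc x t y s : enorm (x - xh) <= r / 2 -> `|t - th| <= r / 2 -> B (y, s) ->
    u x t <= u y s - kquad kx kt x t y s ->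
    [/\ enorm (y - x) < rho1, `|s - t| < rho3, kquad kx kt x t y s <= nu &
        u y s < u x t + nu].
  move=> hx ht By hle.
  have Bx : B (x, t) by apply: inB; clear -hx ht r0; lra.
  have hq2 : kquad kx kt x t y s < 2 * e0.
    have := Bu _ _ By; have := Bu _ _ Bx; rewrite !ltr_norml; clear -hle; lra.
  have [h1 h2] := kquad_lt kx0 kt0 rho10 rho30 hkx hkt hq2.
  have h3 : u y s - u x t < nu.
    apply: (le_lt_trans (ler_norm _)); apply: hu => //; exact: lt_le_trans h2 _.
  have h4 := kquad_ge0 x t y s (ltW kx0) (ltW kt0).
  by split=> //; clear -h3 h4 hle; lra.
have claim j : (j <= m)%N -> exists x : 'rV[R]_n, enorm (x - xh) <= j%:R * h * L /\
    forall y s, B (y, s) -> u y s - kquad kx kt x (th + j%:R * h) y s <=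
      uh + nu + dotv ph (x - xh) + (tauh - 2 * eta) * (j%:R * h).
  elim: j => [_|j IH jm].
    exists xh; rewrite subrr enorm0 !mul0r addr0 dotv0r mulr0 !addr0.
    split=> // y s By.
    have Bh : B (xh, th) by apply: inB; rewrite subrr ?enorm0 ?normr0 ltW.
    have nu0 : 0 < nu.
      by have := hu _ _ _ _ Bh Bh; rewrite !subrr enorm0 normr0; exact.
    have [|hlt] := leP (u y s - kquad kx kt xh th y s) uh; first by clear -nu0; lra.
    have [||_ _ _ hlu] := loc xh th y s _ _ By (ltW hlt).
    - by rewrite subrr enorm0; clear -r0; lra.
    - by rewrite subrr normr0; clear -r0; lra.
    by have := kquad_ge0 xh th y s (ltW kx0) (ltW kt0); move: hlu; rewrite -/uh; clear; lra.
  have [x [hx IHx]] := IH (ltnW jm).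
  set t := th + j%:R * h in IHx.
  have jh : j.+1%:R * h <= sg by rewrite -mh ler_pM2r // ler_nat.
  have j0 : 0 <= j%:R * h by rewrite mulr_ge0 ?ler0n // ltW.
  have jS : j.+1%:R * h = j%:R * h + h by rewrite -natr1 mulrDl mul1r.
  have xr : enorm (x - xh) <= r / 2.
    apply: (le_trans hx); apply: le_trans Lsgr; rewrite mulrC ler_wpM2l //.
    by clear -jh jS h0; lra.
  have tr : `|t - th| <= r / 2.
    by rewrite /t addrC addKr ger0_norm //; clear -jh jS h0 sgr; lra.
  have Bx : B (x, t) by apply: inB; clear -xr tr r0; lra.
  have t0T : 0 <= t <= T by have := BT _ _ Bx; clear; lra.
  have Lx : A2 * enorm x + B2 <= L.
    apply: le_trans AL; rewrite lerD2r ler_wpM2l ?(ham_A2 HH) //.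
    by have := enormD (x - xh) xh; rewrite subrK; clear -xr r0; lra.
  have [q [qL hq]] : exists q, enorm q <= L /\
      forall p', H x t uh ph + dotv q (p' - ph) - eta <= H x t uh p'.
    apply: approx_subgradient => // [p p'|p p' l l01]; last exact: (ham_conv HH).
    apply: (le_trans (ham_p HH _ _ _ _ t0T)); exact: ler_wpM2r.
  set x' := x + h *: q; set t' := t + h.
  have x'x : enorm (x' - x) <= h * L.
    by rewrite /x' addrC addKr enormZ gtr0_norm // ler_pM2l.
  have x'h : enorm (x' - xh) <= j.+1%:R * h * L.
    by rewrite jS; have := enorm_dist x' x xh; clear -x'x hx; lra.
  have x'r : enorm (x' - xh) <= r / 2.
    by apply: (le_trans x'h); apply: le_trans Lsgr; rewrite mulrC ler_wpM2l.
  have t'e : t' = th + j.+1%:R * h by rewrite /t' /t jS addrA.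
  have t'r : `|t' - th| <= r / 2.
    rewrite t'e addrC addKr ger0_norm ?(le_trans jh) //.
    by rewrite mulr_ge0 ?ler0n // ltW.
  have Bx' : B (x', t') by apply: inB; clear -x'r t'r r0; lra.
  exists x'; split=> //; rewrite -t'e.
  have thr2 : th - r <= th + r by clear -r0; lra.
  have [y [s [By hmax']]] := @kquad_max _ _ u xh r _ _ kx kt x' t' (ltW r0) thr2 cuB.
  suff main : u y s - kquad kx kt x' t' y s <=
      uh + nu + dotv ph (x' - xh) + (tauh - 2 * eta) * (j.+1%:R * h).
    by move=> y' s' By'; apply: le_trans main; exact: hmax'.
  have hge : u x' t' <= u y s - kquad kx kt x' t' y s.
    by have := hmax' _ _ Bx'; rewrite kquad_diag subr0.
  have [yx' st' knu _] := loc _ _ _ _ x'r t'r By hge.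
  have s0T := BT _ _ By.
  have hpr : enorm ((2 * kx) *: (y - x')) <= 2 * kx * r.
    rewrite enormZ gtr0_norm ?mulr_gt0 // ler_pM2l ?mulr_gt0 //.
    by clear -yx' rho1r r0; lra.
  have stp : kquad kx kt x t y s - kquad kx kt x' t' y s <= h * (dotv ph q + tauh - 2 * eta).
    apply: (barron_jensen_step HH (uh := uh) (us := u y s) (r := r) (nu := nu)
      (P := 2 * kx * r) eta0 kx0 h0 t0T _ hq qL hk) => //.
    - by clear -s0T; lra.
    - by clear -yx' rho1r r0; lra.
    - by apply: le_trans knu; rewrite lerDl mulr_ge0 ?sqr_ge0 // ltW.
    - by apply: le_trans Ke0; rewrite ler_wpM2l ?(ham_K3 HH) // ltW // Bu.
    - apply: ltW; apply: hHt => //; [by case: By | by case: By | by case: Bx |].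
      have := ler_distD t' s t; rewrite /t' (addrC t) addrK (gtr0_norm h0).
      by clear -st' hr2 rho32; rewrite /t' (addrC t) in st' *; lra.
    - apply: qs => //.
      exists (r / 4) => [|y' s' hy' hs']; first by clear -r0; lra.
      apply: hmax'; apply: inB.
        have := enorm_dist y' y xh; have := enorm_dist y x' xh.
        by clear -hy' yx' rho1r x'r; lra.
      have := ler_distD s s' th; have := ler_distD t' s th.
      by clear -hs' st' rho31 rho1r t'r; lra.
    - exact: BH.
  (* The maximizer for the new centre competes at the old one, so the two maxima differ by at most
     the change of the penalty at that point. *)
  have := IHx _ _ By.
  have -> : dotv ph (x' - xh) = dotv ph (x - xh) + h * dotv ph q.
    by rewrite /x' !dotvDr dotvZr addrAC.
  rewrite jS; clear -stp; lra.
have [x [hx hxB]] := claim m (leqnn m).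
rewrite mh in hx hxB.
have Bx : B (x, th + sg).
  apply: inB; first by rewrite mulrC in hx; clear -hx Lsgr r0; lra.
  by rewrite addrC addKr gtr0_norm //; clear -sgr r0; lra.
have := hxB _ _ Bx; rewrite kquad_diag subr0.
have := hf x; rewrite mulrC => /(_ hx).
clear -nus; lra.
Qed.

(** Replaces nested minima when one parameter has to meet several smallness conditions. *)
Lemma exists_lbound (R : realType) (s : seq R) : all (fun a => 0 < a) s ->
  exists2 c : R, 0 < c & all (fun a => c <= a) s.
Proof.
elim: s => [|a s IH] /=; first by exists 1.
move=> /andP[a0 /IH[c c0 hc]]; exists (Num.min a c); first by rewrite lt_min a0.
rewrite ge_min lexx /=; apply: sub_all hc => b; apply: le_trans.
by rewrite ge_min lexx orbT.
Qed.

Lemma exists_factor (R : realType) (c eta : R) : 0 <= c -> 0 < eta ->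
  exists2 d : R, 0 < d & forall d', 0 <= d' -> d' <= d -> c * d' <= eta.
Proof.
move=> c0 eta0; exists (eta / (c + 1)); first by rewrite divr_gt0 ?ltr_wpDl.
by move=> d' d0; rewrite ler_pdivlMr ?ltr_wpDl // mulrDr mulr1 mulrC; lra.
Qed.

(** A positive value would feed [barron_jensen_path]. The parameters are fixed in the order [eta],
    [L], [e0], [r], [sg], [nu], [rho1], [kx], [rho2], [rho3], [kt], and the time step last. *)
Lemma barron_jensen (R : realType) n T (H : 'rV[R]_n -> R -> R -> 'rV[R]_n -> R)
    (C1 beta A2 B2 K3 : R) (HH : hamiltonian T H C1 beta A2 B2 K3) (u : 'rV[R]_n -> R -> R) :
  cts_on [set Q | 0 < Q.2 < T] u -> quadsub T H u ->
  forall xh th ph tauh, 0 < th < T -> fsub u xh th ph tauh ->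
    tauh + H xh th (u xh th) ph <= 0.
Proof.
move=> cu qs xh th ph tauh tT hf; rewrite leNgt; apply/negP => pos.
have [C10 be0 A20 B20 K30] : [/\ 0 <= C1, 0 <= beta, 0 <= A2, 0 <= B2 & 0 <= K3] by case: HH.
have [th0 thT] := andP tT.
(* The path argument asks for ten of the twelve [eta]; the rest covers the variation of [H] near the
   contact point. *)
have [eta eta0 etaE] : exists2 eta, 0 < eta & 12 * eta = tauh + H xh th (u xh th) ph.
  by exists ((tauh + H xh th (u xh th) ph) / 12); [rewrite divr_gt0 | field].
(* By (H2), [L] bounds the Lipschitz constant of [H] in [p] over the unit ball about [xh], hence the
   speed of the scheme; the condition [r <= 1] keeps the path in that ball. *)
have [L L0 LE] : exists2 L, 0 <= L & A2 * (enorm xh + 1) + B2 = L.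
  by eexists; last reflexivity; rewrite addr_ge0 // mulr_ge0 // addr_ge0.
have [e0 e00 /(_ e0 _ (lexx _)) Ke0] := exists_factor K30 eta0.
have {}Ke0 := Ke0 (ltW e00).
have [d1 d10 hd1] := cu xh th tT e0 e00.
have th0T : 0 <= th <= T by rewrite !ltW.
have [d2 d20 hd2] := ham_cont HH xh (u xh th) ph th0T eta0.
have [d3 d30 hd3] : exists2 d : R, 0 < d & forall x s,
    enorm (x - xh) <= L * s -> 0 < s -> (L + 1) * s < d ->
    u xh th + dotv ph (x - xh) + tauh * s - eta * s <= u x (th + s).
  have L1 : 0 < L + 1 by rewrite ltr_wpDl.
  (* Points reached in time [s] at speed at most [L] satisfy [|x - xh| + s <= (L + 1) s], so the
     error in [fsub] is at most [eta s]. *)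
  have eL : 0 < eta / (L + 1) by rewrite divr_gt0.
  have [d d0 hd] := hf _ eL; exists d => // x s hx s0 hs.
  have Ls : 0 <= L * s by rewrite mulr_ge0 // ltW.
  have e : th + s - th = s by ring.
  have := hd x (th + s); rewrite e gtr0_norm // => hd'.
  have h1 : enorm (x - xh) < d by clear -hx hs s0; lra.
  have h2 : s < d by clear -Ls hs; lra.
  have {}hd' := hd' h1 h2.
  have h3 : eta / (L + 1) * (enorm (x - xh) + s) <= eta * s.
    by rewrite mulrAC ler_pdivrMr // -mulrA ler_pM2l //; clear -hx; lra.
  by clear -hd' h3; lra.
have [r [r00 r01 rt rT [rd1 rd2 rb]]] : exists r, [/\ 0 < r, r <= 1, r <= th / 2,
    r <= (T - th) / 2 & [/\ r < d1, r < d2 & C1 * beta * r <= eta]].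
  have [a a0 ha] := exists_factor (mulr_ge0 C10 be0) eta0.
  have [|c c0 /and5P[c1 c2 c3 c4 /and3P[c5 c6 _]]] :=
    @exists_lbound _ [:: 1; th / 2; (T - th) / 2; d1 / 2; d2 / 2; a].
    by rewrite /= ltr01 a0 !divr_gt0 // subr_gt0.
  exists c; split=> //; split; [| | exact: ha (ltW c0) c6].
    by clear -c4 d10; lra.
  by clear -c5 d20; lra.
have Bd y s : cyl xh r (th - r) (th + r) (y, s) -> [/\ enorm (y - xh) <= r,
    `|s - th| <= r & 0 < s < T].
  by case=> /= h1 h2; rewrite ler_norml; split=> //; clear -h2 rt rT th0 thT; lra.
have cuB : cts_on (cyl xh r (th - r) (th + r)) u.
  by apply: cts_onS cu => -[y s] /Bd[].
have [sg [sg0 sgr Lsgr sgd]] : exists s, [/\ 0 < s, s <= r / 2, L * s <= r / 2 &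
    (L + 1) * s < d3].
  have [|c c0 /and3P[c1 c2 _]] := @exists_lbound _ [:: r / 2; d3 / 2].
    by rewrite /= !divr_gt0.
  have [a a0 /(_ a (ltW a0) (lexx _)) ha] := exists_factor (addr_ge0 L0 ler01) c0.
  have La : 0 <= L * a by rewrite mulr_ge0 // ltW.
  by exists a; split=> //; clear -La ha c1 c2 d30 a0; lra.
have sgL : 0 <= L * sg by rewrite mulr_ge0 // ltW.
have [nu [nu0 nus nuC]] : exists nu, [/\ 0 < nu, nu < eta * sg & 2 * C1 * nu <= eta].
  have es : 0 < eta * sg by rewrite mulr_gt0.
  have [a a0 ha] := exists_factor (mulr_ge0 (ler0n R 2) C10) eta0.
  have [|c c0 /and3P[c1 c2 _]] := @exists_lbound _ [:: eta * sg / 2; a].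
    by rewrite /= divr_gt0 ?a0.
  by exists c; split; [by [] | clear -c1 es; lra | exact: ha (ltW c0) c2].
have [rho0 rho00 hrho0] := unif_cts_on (@cyl_compact _ _ _ _ _ _) cuB nu0.
have [|rho1 rho10 /and3P[rho1u rho1r _]] := @exists_lbound _ [:: rho0; r / 4].
  by rewrite /= rho00 divr_gt0.
have ex_k rho : 0 < rho -> exists2 k, 0 < k & 2 * e0 <= k * rho ^+ 2.
  move=> h; exists (2 * e0 / rho ^+ 2); first by rewrite divr_gt0 ?exprn_gt0 ?mulr_gt0.
  by rewrite divfK // gt_eqF // exprn_gt0.
have [kx kx0 hkx] := ex_k _ rho10.
have thr0 : 0 < th - r by clear -rt th0; lra.
have thrT : th + r < T by clear -rT thT; lra.
have [rho2 rho20 hrho2] := @hamiltonian_unif_time _ _ _ H xh r (th - r) (th + r)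
  `|u xh th| (2 * kx * r) (ham_cont HH) (ltW thr0) (ltW thrT) eta eta0.
have [|rho3 rho30 /and3P[rho31 rho32 _]] := @exists_lbound _ [:: rho1; rho2 / 2].
  by rewrite /= rho10 divr_gt0.
have [kt kt0 hkt] := ex_k _ rho30.
have kL0 : 0 <= kx * L ^+ 2 + kt by rewrite addr_ge0 ?mulr_ge0 ?sqr_ge0 // ltW.
have CP0 : 0 <= C1 * (beta + 2 * kx * r) * L.
  by rewrite !mulr_ge0 // addr_ge0 // !mulr_ge0 // ltW.
have [b1 b10 hb1] := exists_factor kL0 eta0.
have [b2 b20 hb2] := exists_factor CP0 eta0.
have [|hm hm0 /and4P[hm1 hm2 hm3 _]] := @exists_lbound _ [:: rho2 / 2; b1; b2].
  by rewrite /= b10 b20 divr_gt0.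
have [m m0 hm'] := exists_step sg0 hm0.
have hs0 : 0 < sg / m%:R by rewrite divr_gt0 ?ltr0n.
apply: (barron_jensen_path HH (u := u) (xh := xh) (ph := ph) (th := th) (tauh := tauh)
  (eta := eta) (e0 := e0) (r := r) (L := L) (sg := sg) (nu := nu) (rho1 := rho1)
  (rho2 := rho2) (rho3 := rho3) (kx := kx) (kt := kt) (h := sg / m%:R) (m := m)) => //.
- by rewrite -LE lerD2r ler_wpM2l // lerD2l.
- by move=> y s /Bd[h1 h2 h3]; apply: hd1 => //; exact: le_lt_trans rd1.
- move=> y s /Bd[h1 h2 /andP[h3 h4]].
  have /ltr_normlP[h5 _] : `|H y s (u xh th) ph - H xh th (u xh th) ph| < eta.
    apply: hd2; rewrite ?subrr ?normr0 ?enorm0 ?(ltW h3) ?(ltW h4) //.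
      exact: le_lt_trans rd2.
    exact: le_lt_trans rd2.
  by clear -h5 etaE eta0; lra.
- by move=> x hx; apply: hd3.
- exact: le_trans hm1.
- move=> x t y s h1 h2 h3 h4; apply: hrho0 => //; exact: lt_le_trans rho1u.
- by move=> y s t p h1 h2 h3 h4 h5; apply: hrho2.
- by rewrite mulrC divfK // gt_eqF ?ltr0n.
- by rewrite mulrC; apply: hb1; rewrite ?(ltW hs0) //; exact: le_trans hm2.
- rewrite (_ : _ * (_ * L) = C1 * (beta + 2 * kx * r) * L * (sg / m%:R)); last by ring.
  by apply: hb2; rewrite ?(ltW hs0) //; exact: le_trans hm3.
Qed.

(** * Infimum over growing balls *)

(** The affine map between the two balls; it lets a minimizer over one ball compete over a
    neighbouring one. *)
Lemma ball_transport (R : realType) n (x y z : 'rV[R]_n) (a b : R) :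
  0 < a -> 0 <= b -> enorm (z - x) <= a ->
  exists z', enorm (z' - y) <= b /\ enorm (z' - z) <= enorm (y - x) + `|b - a|.
Proof.
move=> a0 b0 hz; exists (y + (b / a) *: (z - x)); split.
  rewrite addrC addKr enormZ ger0_norm ?divr_ge0 ?(ltW a0) //.
  by rewrite mulrAC ler_pdivrMr // ler_wpM2l.
have -> : y + (b / a) *: (z - x) - z = (y - x) + (b / a - 1) *: (z - x).
  by apply/rowP => i; rewrite !mxE; ring.
apply: (le_trans (enormD _ _)); rewrite lerD2l enormZ.
have -> : b / a - 1 = (b - a) / a by field; rewrite gt_eqF.
by rewrite normrM normfV (gtr0_norm a0) mulrAC ler_pdivrMr // ler_wpM2l.
Qed.

(** Continuity of the minimum follows by carrying minimizers in both directions between neighbouring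
    balls, with the uniform continuity of [u] on a cylinder. *)
Lemma ball_inf_exists (R : realType) n T (u : 'rV[R]_n -> R -> R) (rho : R -> R) :
  cts_on [set Q | 0 <= Q.2 < T] u -> (forall t, 0 < rho t) ->
  (forall t e, 0 < e -> exists2 d, 0 < d & forall s, `|s - t| < d -> `|rho s - rho t| < e) ->
  exists v : 'rV[R]_n -> R -> R, [/\
    forall x t, 0 <= t < T -> exists y, enorm (y - x) <= rho t /\ v x t = u y t,
    forall x t y, 0 <= t < T -> enorm (y - x) <= rho t -> v x t <= u y t &
    cts_on [set Q | 0 <= Q.2 < T] v].
Proof.
move=> cu rho0 crho.
have ex x t : 0 <= t < T -> exists y, enorm (y - x) <= rho t /\
    forall y', enorm (y' - x) <= rho t -> u y t <= u y' t.
  move=> tT; have Bx : [set y | enorm (y - x) <= rho t] x by rewrite /= subrr enorm0 ltW.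
  have [|y hy hm] := compact_min (@enorm_ball_compact R n x (rho t)) Bx (f := u^~ t).
    move=> y hy; apply: cvg_within_filter; apply: enorm_continuity => {hy}y e e0.
    have [d d0 hd] := cu y t tT e e0; exists d => // z hz.
    by apply: hd => //; rewrite subrr normr0.
  by exists y.
have /choice[m hm] : forall Q : 'rV[R]_n * R, exists y, 0 <= Q.2 < T ->
    enorm (y - Q.1) <= rho Q.2 /\
    forall y', enorm (y' - Q.1) <= rho Q.2 -> u y Q.2 <= u y' Q.2.
  move=> [x t] /=; have [tT|tT] := boolP (0 <= t < T); last by exists 0.
  by have [y hy] := ex x t tT; exists y.
pose v x t := u (m (x, t)) t.
have vm x t y : 0 <= t < T -> enorm (y - x) <= rho t -> v x t <= u y t.
  by move=> tT; have [_] := hm (x, t) tT; apply.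
have va x t : 0 <= t < T -> exists y, enorm (y - x) <= rho t /\ v x t = u y t.
  by move=> tT; exists (m (x, t)); split=> //; have [] := hm (x, t) tT.
exists v; split=> //.
move=> x t /= tT e e0; have [t0 tlT] := andP tT.
have cuK : cts_on (cyl x (rho t + 2) 0 ((t + T) / 2)) u.
  by apply: cts_onS cu => -[y s] [/= _]; clear -tlT; lra.
have [d1 d10 hd1] := unif_cts_on (@cyl_compact _ _ _ _ _ _) cuK e0.
have [|e1 e10 /and3P[e1a e1b _]] := @exists_lbound _ [:: 1; d1 / 2].
  by rewrite /= ltr01 divr_gt0.
have [d2 d20 hd2] := crho t e1 e10.
have [|d d0 /and5P[da db dc dd _]] := @exists_lbound _ [:: e1; d2; d1; (T - t) / 2].
  by rewrite /= e10 d20 d10 divr_gt0 // subr_gt0.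
exists d => // y s sT hy hs.
have [s0 slT] := andP sT.
have hrho := hd2 s (lt_le_trans hs db).
have st : s <= (t + T) / 2 by move: hs; rewrite ltr_norml; clear -dd; lra.
have tt : t <= (t + T) / 2 by clear -tlT; lra.
have inx z : enorm (z - x) <= rho t -> cyl x (rho t + 2) 0 ((t + T) / 2) (z, t).
  by move=> hz; split=> /=; [clear -hz; lra | rewrite t0].
have iny z : enorm (z - y) <= rho s -> cyl x (rho t + 2) 0 ((t + T) / 2) (z, s).
  move=> hz; split=> /=; last by rewrite s0.
  have := enorm_dist z y x; move: hrho; rewrite ltr_norml.
  by clear -hz hy da e1a; lra.
have [z1 [hz1 v1]] := va x t tT; have [z2 [hz2 v2]] := va y s sT.
have [z3 [hz3 hz31]] := ball_transport y (rho0 t) (ltW (rho0 s)) hz1.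
have [z4 [hz4 hz42]] := ball_transport x (rho0 s) (ltW (rho0 t)) hz2.
have h1 : u z2 s <= u z3 s by rewrite -v2; exact: vm.
have h2 : u z1 t <= u z4 t by rewrite -v1; exact: vm.
have g1 : `|u z3 s - u z1 t| < e.
  by apply: hd1 (inx _ hz1) (iny _ hz3) _ (lt_le_trans hs dc); clear -hz31 hrho hy da e1b; lra.
have g2 : `|u z4 t - u z2 s| < e.
  apply: hd1 (iny _ hz2) (inx _ hz4) _ _; last by rewrite distrC (lt_le_trans hs dc).
  by rewrite enorm_subC distrC in hz42; clear -hz42 hrho hy da e1b; lra.
by rewrite v1 v2; move: g1 g2; rewrite !ltr_norml; clear -h1 h2; lra.
Qed.

Lemma le0_of_quadratic (R : realType) (a b d : R) : 0 < d ->
  (forall s, 0 < s -> s < d -> a * s <= b * s ^+ 2) -> a <= 0.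
Proof.
move=> d0 h; rewrite leNgt; apply/negP => a0.
pose s := Num.min (d / 2) (a / (`|b| + 1) / 2).
have b1 : 0 < `|b| + 1 by rewrite ltr_wpDl.
have s0 : 0 < s by rewrite lt_min !divr_gt0.
have sd : s < d by rewrite /s gt_min; apply/orP; left; clear -d0; lra.
have sa : (`|b| + 1) * s <= a / 2.
  have : s <= a / (`|b| + 1) / 2 by rewrite ge_min lexx orbT.
  by rewrite mulrAC ler_pdivlMr // mulrC.
have := h s s0 sd; rewrite expr2 mulrA ler_pM2r // leNgt => /negP; apply.
apply: (@le_lt_trans _ _ (a / 2)); last by clear -a0; lra.
apply: le_trans sa; rewrite ler_pM2r //.
by have := ler_norm b; clear; lra.
Qed.

Lemma kquad_sub (R : realType) n (kx kt : R) (a x y : 'rV[R]_n) (b t s : R) :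
  kquad kx kt a b y s = kquad kx kt a b x t + 2 * kx * dotv (x - a) (y - x) +
    2 * kt * (t - b) * (s - t) + kquad kx kt x t y s.
Proof.
have e : y - a = (x - a) + (y - x) by rewrite [RHS]addrC addrA subrK.
rewrite /kquad e !sqr_enorm; move: (x - a) (y - x) => z w.
by rewrite !dotvE (dotvC w z); ring.
Qed.

(** Each [y'] near the minimizer [y] lies, at time [s], in the ball about a point [X] near [x], so
    [v X s <= u y' s] and the quadratic below [v] is pulled back along [y' -> X]. Since
    [p.(y - x) = - |p| rho t], the change of radius adds [rho' |p|] to the time slope. *)
Lemma fsub_quad_expR (R : realType) n (C1 rho0 : R) (T : R) (u v : 'rV[R]_n -> R -> R) :
  let rho := fun t => rho0 * expR (C1 * t) in
  0 <= C1 -> 0 < rho0 ->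
  (forall x t, 0 <= t < T -> exists y, enorm (y - x) <= rho t /\ v x t = u y t) ->
  (forall x t y, 0 <= t < T -> enorm (y - x) <= rho t -> v x t <= u y t) ->
  forall (kx kt : R) (a x : 'rV[R]_n) (b t d : R), 0 < kx -> 0 < kt -> 0 < t < T -> 0 < d ->
  (forall x' t', enorm (x' - x) < d -> `|t' - t| < d ->
     v x t + kquad kx kt a b x t <= v x' t' + kquad kx kt a b x' t') ->
  let p := - ((2 * kx) *: (x - a)) in
  exists y, [/\ enorm (y - x) <= rho t, v x t = u y t &
    fsub u y t p (- (2 * kt * (t - b)) + C1 * rho t * enorm p)].
Proof.
move=> rho C10 rho00 va vm kx kt a x b t d kx0 kt0 tT d0 hmin p.
have [t0 tlT] := andP tT.
have t0T : 0 <= t < T by rewrite ltW.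
have rhop s : 0 < rho s by rewrite mulr_gt0 // expR_gt0.
have [y [hy vy]] := va x t t0T; exists y; split=> //.
have px w : dotv p w = - (2 * kx * dotv (x - a) w) by rewrite dotvNl dotvZl.
have pyx : dotv p (y - x) = - (enorm p * rho t).
  apply/eqP; rewrite eq_le; apply/andP; split; last first.
    by apply: le_trans (dotv_ge _ _); rewrite lerN2 ler_wpM2l.
  have [p0|p0] := eqVneq (enorm p) 0.
    by rewrite (enorm_eq0 p0) dotv0l enorm0 mul0r oppr0.
  have pp : 0 < enorm p by rewrite lt_neqAle eq_sym p0 enorm_ge0.
  (* When [x] moves towards [y + (rho t / |p|) p], the point [y] stays in the ball, so [v] does not
     exceed [v x t] there; the first-order condition becomes [dotv p w <= 0], that is
     [p.(y - x) <= - |p| rho t]. *)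
  pose w := y + (rho t / enorm p) *: p - x.
  suff : dotv p w <= 0.
    rewrite /w addrAC dotvDr dotvZr -sqr_enorm expr2 mulrA divfK // (mulrC (rho t)).
    by clear; lra.
  have w1 : 0 < enorm w + 1 by rewrite ltr_wpDl.
  apply: (@le0_of_quadratic _ _ (kx * enorm w ^+ 2) (Num.min 1 (d / (enorm w + 1)))).
    by rewrite lt_min ltr01 divr_gt0.
  move=> s s0; rewrite lt_min => /andP[s1]; rewrite ltr_pdivlMr // => sd.
  have hs : enorm (x + s *: w - x) < d.
    rewrite addrC addKr enormZ gtr0_norm //.
    by have := enorm_ge0 w; clear -sd s0; lra.
  have := hmin (x + s *: w) t hs; rewrite subrr normr0 => /(_ d0).
  rewrite (kquad_sub kx kt a x (x + s *: w) b t t) subrr.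
  rewrite /kquad (addrC x (s *: w)) addrK subrr expr0n /= enormZ (gtr0_norm s0) dotvZr.
  have : v (s *: w + x) t <= v x t.
    rewrite vy; apply: vm => //.
    have -> : y - (s *: w + x) = (1 - s) *: (y - x) - (s * (rho t / enorm p)) *: p.
      by rewrite /w; apply/rowP => i; rewrite !mxE; ring.
    have h1 : 0 <= 1 - s by rewrite subr_ge0 ltW.
    have h2 : 0 <= s * (rho t / enorm p) by rewrite mulr_ge0 ?divr_ge0 // ltW.
    apply: (le_trans (enormD _ _)); rewrite enormN !enormZ (ger0_norm h1) (ger0_norm h2).
    rewrite -mulrA divfK //.
    by have := ler_wpM2l h1 hy; clear; lra.
  rewrite px exprMn; clear; lra.
move=> e e0.
have rhoT0 : 0 <= C1 * rho T by rewrite mulr_ge0 // ltW.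
(* Lipschitz constant of the map from [(y', s)] to [X] below: a unit for the shift in space,
   [C1 * rho T] for the change of radius. *)
pose M := C1 * rho T + 1.
have M0 : 0 < M by rewrite ltr_wpDl.
have kM0 : 0 <= 2 * (kx * M ^+ 2 + kt).
  by rewrite mulr_ge0 // addr_ge0 ?mulr_ge0 ?sqr_ge0 // ltW.
have [f f0 hf] := exists_factor kM0 e0.
have [|c c0 /and5P[c1 c2 c3 c4 /andP[c5 _]]] :=
    @exists_lbound _ [:: t / 2; (T - t) / 2; d / (2 * M); d; f].
  by rewrite /= d0 f0 !divr_gt0 ?subr_gt0 // mulr_gt0.
exists c => // y' s hy' hs.
have sT : 0 <= s < T by move: hs; rewrite ltr_norml; clear -c1 c2 t0 tlT; lra.
have mono a1 a2 : a1 <= a2 -> rho a1 <= rho a2.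
  by move=> h; rewrite ler_pM2l // ler_expR ler_wpM2l.
(* Convexity of [rho] bounds its increments below by the linear part; multiplied by [|p|], this has
   the sign that a subgradient needs. *)
have cvx a1 a2 : C1 * rho a1 * (a2 - a1) <= rho a2 - rho a1.
  have e1 : rho a1 * expR (C1 * (a2 - a1)) = rho a2.
    by rewrite /rho -mulrA -expRD; congr (_ * expR _); ring.
  have := expR_ge1Dx (C1 * (a2 - a1)).
  by rewrite -(ler_pM2l (rhop a1)) e1; clear; lra.
pose D := rho s - rho t.
have D1 : C1 * rho t * (s - t) <= D by exact: cvx.
have lipS a1 a2 : a1 <= a2 -> a2 <= T -> `|rho a2 - rho a1| <= C1 * rho T * (a2 - a1).
  move=> h hT; rewrite ger0_norm ?subr_ge0 ?mono //.
  have := cvx a2 a1.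
  have : C1 * rho a2 * (a2 - a1) <= C1 * rho T * (a2 - a1).
    by rewrite ler_wpM2r ?subr_ge0 // ler_wpM2l // mono.
  by clear; lra.
have D2 : `|D| <= C1 * rho T * `|s - t|.
  have [st|st] := leP t s.
    rewrite (ger0_norm (_ : 0 <= s - t)) ?subr_ge0 //.
    by apply: lipS => //; clear -sT; lra.
  have -> : `|s - t| = t - s by rewrite distrC gtr0_norm ?subr_gt0.
  by rewrite /D distrC; apply: lipS; exact: ltW.
(* A centre whose ball at time [s] contains [y']: the offset [y - x] is rescaled to the radius at
   time [s]. *)
pose X := y' - (rho s / rho t) *: (y - x).
have Xx : X - x = (y' - y) - (D / rho t) *: (y - x).
  have -> : D / rho t = rho s / rho t - 1 by rewrite /D; field; rewrite gt_eqF.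
  by apply/rowP => i; rewrite !mxE; ring.
have hX : enorm (X - x) <= M * (enorm (y' - y) + `|s - t|).
  rewrite Xx; apply: (le_trans (enormD _ _)); rewrite enormN enormZ.
  have h1 : `|D / rho t| * enorm (y - x) <= `|D|.
    by rewrite normrM normfV (gtr0_norm (rhop t)) mulrAC ler_pdivrMr // ler_wpM2l.
  have := mulr_ge0 rhoT0 (enorm_ge0 (y' - y)); have := normr_ge0 (s - t).
  by rewrite /M; clear -h1 D2; lra.
have hXd : enorm (X - x) < d.
  apply: (le_lt_trans hX); apply: (@lt_le_trans _ _ (M * (2 * c))).
    by rewrite ltr_pM2l //; clear -hy' hs; lra.
  by move: c3; rewrite ler_pdivlMr ?mulr_gt0 //; clear; lra.
have uX : v X s <= u y' s.
  apply: vm => //; rewrite /X opprB addrC subrK enormZ gtr0_norm ?divr_gt0 //.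
  by rewrite mulrAC ler_pdivrMr // ler_wpM2l // ltW.
have := hmin X s hXd (lt_le_trans hs c4).
rewrite (kquad_sub kx kt a x X b t s).
have pX : 2 * kx * dotv (x - a) (X - x) = - (dotv p (y' - y) + D * enorm p).
  rewrite -[LHS]opprK -px Xx dotvDr dotvNr dotvZr pyx; congr (- (_ + _)).
  by field; rewrite gt_eqF.
rewrite pX.
have Dp : C1 * rho t * (s - t) * enorm p <= D * enorm p by rewrite ler_wpM2r.
have kq : kquad kx kt x t X s <= e * (enorm (y' - y) + `|s - t|).
  set w := enorm (y' - y) + `|s - t| in hX *.
  have w0 : 0 <= w by rewrite addr_ge0.
  have wc : w <= 2 * c by rewrite /w; clear -hy' hs; lra.
  apply: (@le_trans _ _ ((kx * M ^+ 2 + kt) * (w * w))).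
    rewrite /kquad mulrDl; apply: lerD.
      rewrite -mulrA ler_pM2l // -expr2 -exprMn ler_pXn2r ?nnegrE //.
      by rewrite mulr_ge0 // ltW.
    rewrite ler_pM2l // -expr2 -real_normK ?num_real // ler_pXn2r ?nnegrE //.
    by rewrite /w lerDr.
  rewrite mulrA ler_wpM2r //; apply: le_trans (hf c (ltW c0) c5).
  rewrite [leRHS](_ : _ = (kx * M ^+ 2 + kt) * (2 * c)); last by ring.
  by rewrite ler_wpM2l // addr_ge0 ?mulr_ge0 ?sqr_ge0 // ltW.
by rewrite -vy; clear -Dp kq uX; lra.
Qed.

(** For [w(x, t) = - v(x, T - t)] one has [w_t = v_t] at the reflected time, so
    [v_t + H <= c(T - t)] turns into an inequality of the same direction for [w]. Reversing time and
    sign together keeps the Hamiltonian convex in the gradient. *)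
Lemma hamiltonian_reverse (R : realType) n T (H : 'rV[R]_n -> R -> R -> 'rV[R]_n -> R)
    (C1 beta A2 B2 K3 : R) (c : R -> R) :
  (forall t e, 0 < e -> exists2 d, 0 < d & forall s, `|s - t| < d -> `|c s - c t| < e) ->
  hamiltonian T H C1 beta A2 B2 K3 ->
  hamiltonian T (fun x t w p => H x (T - t) (- w) (- p) - c t) C1 beta A2 B2 K3.
Proof.
move=> cc HH; have rT (t : R) : 0 <= t <= T -> 0 <= T - t <= T by clear; lra.
have sub2 (a b d : R) : (a - d) - (b - d) = a - b by ring.
split; try by case: HH.
- move=> x t v p tT e e0; have e2 : 0 < e / 2 by rewrite divr_gt0.
  have [d1 d10 hd1] := ham_cont HH x (- v) (- p) (rT _ tT) e2.
  have [d2 d20 hd2] := cc t _ e2.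
  have [|d d0 /and3P[da db _]] := @exists_lbound _ [:: d1; d2]; first by rewrite /= d10 d20.
  exists d => // y s w q sT hy hs hw hq.
  have h1 : `|H y (T - s) (- w) (- q) - H x (T - t) (- v) (- p)| < e / 2.
    apply: hd1; first exact: rT.
    - exact: lt_le_trans da.
    - rewrite (_ : T - s - (T - t) = - (s - t)) ?normrN; last by ring.
      exact: lt_le_trans da.
    - by rewrite -opprD normrN; exact: lt_le_trans da.
    - by rewrite -opprD enormN; exact: lt_le_trans da.
  have h2 := hd2 s (lt_le_trans hs db).
  by move: h1 h2; rewrite !ltr_norml; clear; lra.
- by move=> x y t v p tT; rewrite sub2 -(enormN p); apply: (ham_x HH); exact: rT.
- move=> x t v p q tT; rewrite sub2 -(enormN (p - q)) opprD.
  by apply: (ham_p HH); exact: rT.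
- move=> x t v w p tT; rewrite sub2 -(normrN (v - w)) opprD.
  by apply: (ham_u HH); exact: rT.
move=> x t v p q l tT l01; rewrite opprD -!scalerN.
have := ham_conv HH x (- v) (- p) (- q) (rT _ tT) l01; clear; lra.
Qed.

Lemma expR_mul_cts (R : realType) (a b : R) t e : 0 < e -> exists2 d, 0 < d &
  forall s, `|s - t| < d -> `|b * expR (a * s) - b * expR (a * t)| < e.
Proof.
move=> e0; have : (fun s : R => b * expR (a * s)) @ t --> b * expR (a * t).
  apply: cvgM; first exact: cvg_cst.
  apply: (continuous_cvg _ (@continuous_expR R _)).
  by apply: cvgM; [exact: cvg_cst | exact: cvg_id].
move=> /cvgrPdist_lt/(_ e e0)/nbhs_ballP[d /= d0 hd]; exists d => // s hs.
by rewrite distrC; apply: hd; rewrite /ball /= distrC.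
Qed.

(** [D^+ v] is encoded as [D^-] of [- v] with both slopes negated. In reversed time [quadsub] for
    [- v] asks only about quadratics below [v], and [fsub_quad_expR] sends these to [D^- u] at a
    minimizer. *)
Lemma ball_inf_supersub (R : realType) n T (H : 'rV[R]_n -> R -> R -> 'rV[R]_n -> R)
    (C1 beta A2 B2 K3 rho0 : R) (HH : hamiltonian T H C1 beta A2 B2 K3)
    (u v : 'rV[R]_n -> R -> R) :
  let rho := fun t => rho0 * expR (C1 * t) in
  0 < rho0 -> cts_on [set Q | 0 <= Q.2 < T] u -> quadsub T H u ->
  (forall x t, 0 <= t < T -> exists y, enorm (y - x) <= rho t /\ v x t = u y t) ->
  (forall x t y, 0 <= t < T -> enorm (y - x) <= rho t -> v x t <= u y t) ->
  cts_on [set Q | 0 <= Q.2 < T] v ->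
  forall x t p tau, 0 < t < T -> fsub (fun y s => - v y s) x t (- p) (- tau) ->
    tau + H x t (v x t) p <= C1 * beta * rho t.
Proof.
move=> rho rho00 cu qs va vm cv x t p tau tT hf.
have C10 := ham_C1 HH; have be0 := ham_beta HH.
(* The error [C1 beta rho] read in reversed time, written as a multiple of one exponential. *)
pose c s := C1 * beta * rho0 * expR (C1 * T) * expR (- C1 * s).
have cE s : c (T - s) = C1 * beta * rho s.
  rewrite /c /rho -!mulrA -expRD; congr (_ * (_ * (_ * expR _))); ring.
pose w y s := - v y (T - s).
pose G x t w p := H x (T - t) (- w) (- p) - c t.
have HG : hamiltonian T G C1 beta A2 B2 K3.
  by apply: (hamiltonian_reverse (c := c) _ HH) => s e e0; exact: expR_mul_cts.
have rT s : 0 < s < T -> 0 < T - s < T by clear; lra.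
have S0 : [set Q | 0 < Q.2 < T] `<=` [set Q : 'rV[R]_n * R | 0 <= Q.2 < T].
  by move=> [y s] /=; clear; lra.
have cw : cts_on [set Q | 0 < Q.2 < T] w.
  move=> y s /= /rT sT e e0.
  have [d d0 hd] := (cts_onS S0 cv : cts_on _ _) y (T - s) sT e e0.
  exists d => // y' s' /= /rT s'T hy hs.
  rewrite /w -opprD normrN; apply: hd => //.
  by rewrite (_ : T - s' - (T - s) = - (s' - s)) ?normrN //; ring.
have qw : quadsub T G w.
  move=> kx kt a b y s kx0 kt0 sT [d d0 hd].
  have kr y' s' : kquad kx kt a (T - b) y' (T - s') = kquad kx kt a b y' s'.
    by rewrite /kquad (_ : T - s' - (T - b) = - (s' - b)) ?sqrrN //; ring.
  have hmin y' t' : enorm (y' - y) < d -> `|t' - (T - s)| < d ->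
      v y (T - s) + kquad kx kt a (T - b) y (T - s) <= v y' t' + kquad kx kt a (T - b) y' t'.
    move=> hy' ht'; have := hd y' (T - t') hy'.
    rewrite (_ : T - t' - s = - (t' - (T - s))) ?normrN; last by ring.
    move=> /(_ ht'); rewrite /w -kr subKr kr; clear; lra.
  have [z [hz vz]] := fsub_quad_expR C10 rho00 va vm kx0 kt0 (rT _ sT) d0 hmin.
  set q := - ((2 * kx) *: (y - a)) => hq.
  have := barron_jensen HH (cts_onS S0 cu) qs (rT _ sT) hq; rewrite -vz => hbj.
  have tsT : 0 <= T - s <= T by move: (rT _ sT); clear; lra.
  have := ham_x HH y z (v y (T - s)) q tsT; rewrite ler_norml => /andP[_].
  have : C1 * (beta + enorm q) * enorm (y - z) <= C1 * (beta + enorm q) * rho (T - s).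
    by rewrite enorm_subC ler_wpM2l // mulr_ge0 // addr_ge0.
  have : c s = C1 * beta * rho (T - s) by rewrite -cE subKr.
  have : 2 * kt * (T - s - (T - b)) = - (2 * kt * (s - b)) by ring.
  move: hbj; rewrite /G /w opprK -/q.
  by move=> hbj e; rewrite e in hbj; move: hbj; rewrite /rho; clear; lra.
have hw : fsub w x (T - t) (- p) tau.
  move=> e e0; have [d d0 hd] := hf e e0; exists d => // y s hy hs.
  have e1 : T - s - t = - (s - (T - t)) by ring.
  have := hd y (T - s) hy; rewrite e1 normrN => /(_ hs).
  by rewrite /w subKr; clear; lra.
have := barron_jensen HG cw qw (rT _ tT) hw.
by rewrite /G /w subKr !opprK cE; clear; lra.
Qed.

(** * Slope of the initial datum *)

(** The norm of [(w, k)]: a smoothing of the Euclidean norm, differentiable at the origin when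
    [k > 0]. *)
Definition snorm {R : realType} {n : nat} (k : R) (w : 'rV[R]_n) : R :=
  Num.sqrt (enorm w ^+ 2 + k ^+ 2).

Lemma sqr_snorm (R : realType) n k (w : 'rV[R]_n) : snorm k w ^+ 2 = enorm w ^+ 2 + k ^+ 2.
Proof. by rewrite sqr_sqrtr // addr_ge0 ?sqr_ge0. Qed.

Lemma snorm_ge0 (R : realType) n k (w : 'rV[R]_n) : 0 <= snorm k w.
Proof. exact: sqrtr_ge0. Qed.

Lemma enorm_le_snorm (R : realType) n k (w : 'rV[R]_n) : enorm w <= snorm k w.
Proof. by rewrite -(@ler_pXn2r _ 2) ?nnegrE ?snorm_ge0 // sqr_snorm lerDl sqr_ge0. Qed.

Lemma snorm_ge (R : realType) n k (w : 'rV[R]_n) : 0 <= k -> k <= snorm k w.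
Proof.
by move=> k0; rewrite -(@ler_pXn2r _ 2) ?nnegrE ?snorm_ge0 // sqr_snorm lerDr sqr_ge0.
Qed.

Lemma snorm0 (R : realType) n (k : R) : 0 <= k -> snorm k (0 : 'rV[R]_n) = k.
Proof. by move=> k0; rewrite /snorm enorm0 expr0n add0r sqrtr_sqr ger0_norm. Qed.

Lemma snorm_lip (R : realType) n k (w w' : 'rV[R]_n) :
  `|snorm k w' - snorm k w| <= enorm (w' - w).
Proof.
rewrite -(@ler_pXn2r _ 2) ?nnegrE // real_normK ?num_real //.
rewrite sqr_enorm !dotvE (dotvC w' w) -!sqr_enorm sqrrB !sqr_snorm.
suff : dotv w w' + k ^+ 2 <= snorm k w' * snorm k w by clear; lra.
apply: (@le_trans _ _ (enorm w * enorm w' + k ^+ 2)); first by rewrite lerD2r dotv_le.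
have p1 : 0 <= enorm w * enorm w' + k ^+ 2 by rewrite addr_ge0 ?sqr_ge0 ?mulr_ge0.
have p2 : 0 <= snorm k w' * snorm k w by exact: mulr_ge0 (snorm_ge0 _ _) (snorm_ge0 _ _).
rewrite -(@ler_pXn2r _ 2) ?nnegrE // exprMn !sqr_snorm.
have := mulr_ge0 (sqr_ge0 k) (sqr_ge0 (enorm w - enorm w')).
by move: (enorm w) (enorm w') => a b; clear; lra.
Qed.

(** The remainder times [snorm k w] is exactly half of [|w' - w|^2 - (snorm k w' - snorm k w)^2],
    and [snorm k w >= k]. *)
Lemma snorm_taylor (R : realType) n k (w w' : 'rV[R]_n) : 0 < k ->
  `|snorm k w' - snorm k w - dotv ((snorm k w)^-1 *: w) (w' - w)| <=
    enorm (w' - w) ^+ 2 / k.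
Proof.
move=> k0; have s0 : 0 < snorm k w by apply: lt_le_trans (snorm_ge w (ltW k0)).
have h1 := snorm_lip k w w'.
have h2 : (snorm k w' - snorm k w) ^+ 2 <= enorm (w' - w) ^+ 2.
  by rewrite -real_normK ?num_real // ler_pXn2r ?nnegrE.
have e : snorm k w * (snorm k w' - snorm k w - dotv ((snorm k w)^-1 *: w) (w' - w)) =
   (enorm (w' - w) ^+ 2 - (snorm k w' - snorm k w) ^+ 2) / 2.
  rewrite dotvZl mulrBr mulVKf ?gt_eqF //.
  rewrite [in RHS]sqrrB !sqr_snorm mulrBr -expr2 sqr_snorm !sqr_enorm !dotvE (dotvC w' w).
  by field.
rewrite -(ler_pM2l s0) -{1}(gtr0_norm s0) -normrM e.
rewrite ger0_norm; last by rewrite divr_ge0 // subr_ge0.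
apply: (@le_trans _ _ (k * (enorm (w' - w) ^+ 2 / k))); last first.
  by rewrite ler_wpM2r ?divr_ge0 ?sqr_ge0 ?(ltW k0) // snorm_ge // ltW.
rewrite [leRHS]mulrC divfK ?gt_eqF //.
have := sqr_ge0 (snorm k w' - snorm k w); have := sqr_ge0 (enorm (w' - w)).
by clear; lra.
Qed.

Lemma snorm_C1 (R : realType) n (c k : R) (x : 'rV[R]_n) : 0 < k ->
  C1_space (fun y => c * snorm k (y - x)) (fun y => (c / snorm k (y - x)) *: (y - x)).
Proof.
move=> k0 z e e0.
have sp w : 0 < snorm k (w : 'rV[R]_n) by apply: lt_le_trans (snorm_ge w (ltW k0)).
have [d d0 hd] := exists_factor (normr_ge0 c) (mulr_gt0 e0 k0).
exists (d / 2) => [|y hy]; first by rewrite divr_gt0.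
have e1 : y - x - (z - x) = y - z by rewrite opprB addrA subrK.
have yz0 := enorm_ge0 (y - z).
have cy : 2 * (`|c| * enorm (y - z)) < e * k.
  have [c0|c0] := eqVneq c 0; first by rewrite c0 normr0 mul0r mulr0 mulr_gt0.
  have cc : 0 < `|c| by rewrite normr_gt0.
  apply: lt_le_trans (hd d (ltW d0) (lexx _)).
  by rewrite mulrCA ltr_pM2l //; clear -hy; lra.
split.
  have := snorm_taylor (z - x) (y - x) k0; rewrite e1 => ht.
  have -> : c * snorm k (y - x) - c * snorm k (z - x) -
      dotv ((c / snorm k (z - x)) *: (z - x)) (y - z) =
      c * (snorm k (y - x) - snorm k (z - x) -
           dotv ((snorm k (z - x))^-1 *: (z - x)) (y - z)).
    by rewrite !dotvZl; ring.
  rewrite normrM; apply: (le_trans (ler_wpM2l (normr_ge0 c) ht)).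
  rewrite expr2 !mulrA ler_pdivrMr // [leRHS]mulrAC ler_wpM2r //.
  by have := mulr_ge0 (normr_ge0 c) yz0; clear -cy; lra.
have -> : (c / snorm k (y - x)) *: (y - x) - (c / snorm k (z - x)) *: (z - x) =
   (c / snorm k (y - x)) *: ((y - z) +
      ((snorm k (z - x) - snorm k (y - x)) / snorm k (z - x)) *: (z - x)).
  apply/rowP => i; rewrite !mxE; field.
  by rewrite !gt_eqF.
rewrite enormZ normrM normfV (gtr0_norm (sp _)) mulrAC ltr_pdivrMr ?sp //.
apply: (@lt_le_trans _ _ (e * k)); last by rewrite ler_pM2l // snorm_ge // ltW.
apply: le_lt_trans cy; rewrite mulrCA ler_wpM2l //.
apply: (le_trans (enormD _ _)); rewrite enormZ normrM normfV (gtr0_norm (sp _)).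
suff : `|snorm k (z - x) - snorm k (y - x)| / snorm k (z - x) * enorm (z - x) <= enorm (y - z).
  by clear; lra.
rewrite mulrAC ler_pdivrMr ?sp //; apply: ler_pM => //; last exact: enorm_le_snorm.
by rewrite -e1 distrC; exact: snorm_lip.
Qed.

(** Otherwise [u0] plus a cone of slope slightly below [theta], smoothed at its vertex [x], would
    attain its minimum over the ball at an interior point, where [u0] would have a subgradient
    shorter than [theta]. *)
Lemma initial_slope (R : realType) n (u0 : 'rV[R]_n -> R) (x0 : 'rV[R]_n) (r theta : R) :
  lipschitz_fun u0 -> 0 < theta ->
  (forall x p, enorm (x - x0) < r -> subdiff u0 x p -> theta <= enorm p) ->
  forall x a, 0 < a -> enorm (x - x0) + a < r ->
  exists y, enorm (y - x) <= a /\ u0 y <= u0 x - theta * a.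
Proof.
move=> [L uL] theta0 HU x a a0 hxa.
have cu : continuous u0 := lipschitz_continuous uL.
have Bx : [set y | enorm (y - x) <= a] x by rewrite /= subrr enorm0 ltW.
have [|m /= ma hm] := compact_min (@enorm_ball_compact R n x a) Bx (f := u0).
  by move=> y _; apply: cvg_within_filter; exact: cu.
exists m; split=> //; rewrite leNgt; apply/negP => hlt.
have [th [th0 tht hth]] : exists th, [/\ 0 < th, th < theta & u0 x - th * a < u0 m].
  have [|c c0 /and3P[c1 c2 _]] :=
      @exists_lbound _ [:: theta / 2; (u0 m - (u0 x - theta * a)) / (2 * a)].
    by rewrite /= !divr_gt0 ?subr_gt0 // mulr_gt0.
  exists (theta - c); split; [by clear -c1 theta0; lra | by clear -c0; lra |].
  by move: c2; rewrite ler_pdivlMr ?mulr_gt0 //; clear -hlt; lra.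
(* With this [k] the value [u0 x + th k] at the centre is below every value on the sphere, which is
   at least [u0 m + th a = u0 x + 2 th k]. *)
pose k := (u0 m - (u0 x - th * a)) / (2 * th).
have k0 : 0 < k by rewrite divr_gt0 ?subr_gt0 // mulr_gt0.
have hk : 2 * th * k = u0 m - (u0 x - th * a) by rewrite /k mulrC divfK // gt_eqF // mulr_gt0.
have [|z /= za hz] := compact_min (@enorm_ball_compact R n x a) Bx
    (f := fun y => u0 y + th * snorm k (y - x)).
  move=> y _; apply: cvg_within_filter; apply: (@lipschitz_continuous _ _ _ (L + th)) => {}y y'.
  rewrite (_ : _ - _ = (u0 y - u0 y') + th * (snorm k (y - x) - snorm k (y' - x))); last by ring.
  apply: (le_trans (ler_normD _ _)); rewrite normrM (gtr0_norm th0) mulrDl lerD // ler_pM2l //.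
  by apply: (le_trans (snorm_lip _ _ _)); rewrite opprB addrA subrK.
have hzx := hz x Bx; rewrite subrr snorm0 ?(ltW k0) // in hzx.
have zlt : enorm (z - x) < a.
  rewrite lt_neqAle za andbT; apply/eqP => zE.
  have := enorm_le_snorm k (z - x); rewrite zE -(ler_pM2l th0).
  by have := hm z za; clear -hzx hk hth; lra.
have sp : 0 < snorm k (z - x) by apply: lt_le_trans (snorm_ge _ (ltW k0)).
have := HU z ((- th / snorm k (z - x)) *: (z - x)) _ _.
have zr : enorm (z - x0) < r by have := enorm_dist z x x0; clear -hxa zlt; lra.
move=> /(_ zr); have sd : subdiff u0 z ((- th / snorm k (z - x)) *: (z - x)).
  exists (fun y => - th * snorm k (y - x)), (fun y => (- th / snorm k (y - x)) *: (y - x)).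
  split; first exact: snorm_C1.
  split=> //; exists (a - enorm (z - x)) => [|y hy]; first by rewrite subr_gt0.
  have ya : enorm (y - x) <= a by have := enorm_dist y z x; clear -hy; lra.
  by have := hz y ya; clear; lra.
move=> /(_ sd); rewrite enormZ normrM normrN normfV (gtr0_norm th0) (gtr0_norm sp).
apply/negP; rewrite -ltNge mulrAC ltr_pdivrMr //.
apply: (@le_lt_trans _ _ (th * snorm k (z - x))).
  by rewrite ler_pM2l // enorm_le_snorm.
by rewrite ltr_pM2r.
Qed.

(** * Comparison *)

Definition fdiff {R : realType} {n : nat} (f : 'rV[R]_n -> R -> R) (x : 'rV[R]_n) (t : R)
    (p : 'rV[R]_n) (tau : R) : Prop :=
  forall e : R, 0 < e -> exists2 d : R, 0 < d & forall (y : 'rV[R]_n) (s : R),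
    enorm (y - x) < d -> `|s - t| < d ->
    `|f y s - f x t - (dotv p (y - x) + tau * (s - t))| <= e * (enorm (y - x) + `|s - t|).

Lemma fdiff_linear (R : realType) n (f : 'rV[R]_n -> R -> R) x t p tau :
  (forall y s, f y s - f x t = dotv p (y - x) + tau * (s - t)) -> fdiff f x t p tau.
Proof.
move=> h e e0; exists 1 => // y s _ _; rewrite h subrr normr0.
by rewrite mulr_ge0 ?addr_ge0 // ltW.
Qed.

Lemma fdiff_cst (R : realType) n (c : R) (x : 'rV[R]_n) t : fdiff (fun _ _ => c) x t 0 0.
Proof. by apply: fdiff_linear => y s; rewrite dotv0l mul0r subrr addr0. Qed.

Lemma fdiff_time (R : realType) n (c : R) (x : 'rV[R]_n) t : fdiff (fun _ s => c * s) x t 0 c.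
Proof. by apply: fdiff_linear => y s; rewrite dotv0l add0r mulrBr. Qed.

Lemma fdiffD (R : realType) n (f g : 'rV[R]_n -> R -> R) x t p q a b :
  fdiff f x t p a -> fdiff g x t q b ->
  fdiff (fun y s => f y s + g y s) x t (p + q) (a + b).
Proof.
move=> hf hg e e0; have e2 : 0 < e / 2 by rewrite divr_gt0.
have [d1 d10 hd1] := hf _ e2; have [d2 d20 hd2] := hg _ e2.
have [|d d0 /and3P[h1 h2 _]] := @exists_lbound _ [:: d1; d2]; first by rewrite /= d10 d20.
exists d => // y s hy hs.
have := hd1 y s (lt_le_trans hy h1) (lt_le_trans hs h1).
have := hd2 y s (lt_le_trans hy h2) (lt_le_trans hs h2).
by rewrite dotvDl !ler_norml; clear; lra.
Qed.

Lemma fdiff_lip (R : realType) n (f : 'rV[R]_n -> R -> R) x t p a : fdiff f x t p a ->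
  exists2 C, 0 < C & exists2 d, 0 < d & forall y s, enorm (y - x) < d -> `|s - t| < d ->
    `|f y s - f x t| <= C * (enorm (y - x) + `|s - t|).
Proof.
move=> hf; exists (enorm p + `|a| + 1); first by rewrite ltr_wpDl ?addr_ge0.
have [d d0 hd] := hf 1 ltr01; exists d => // y s hy hs.
have := hd y s hy hs; set z := dotv _ _ + _ => hz.
rewrite (_ : f y s - f x t = (f y s - f x t - z) + z); last by rewrite subrK.
have hz2 : `|z| <= enorm p * enorm (y - x) + `|a| * `|s - t|.
  by rewrite -normrM; apply: (le_trans (ler_normD _ _)); rewrite lerD2r dotv_norm_le.
apply: (le_trans (ler_normD _ _)).
have := mulr_ge0 (enorm_ge0 p) (normr_ge0 (s - t)).
have := mulr_ge0 (normr_ge0 a) (enorm_ge0 (y - x)).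
by clear -hz hz2; lra.
Qed.

Lemma fdiffM (R : realType) n (f g : 'rV[R]_n -> R -> R) x t p q a b :
  fdiff f x t p a -> fdiff g x t q b ->
  fdiff (fun y s => f y s * g y s) x t (f x t *: q + g x t *: p) (f x t * b + g x t * a).
Proof.
move=> hf hg e e0; have e3 : 0 < e / 3 by rewrite divr_gt0.
have [C C0 [d1 d10 hd1]] := fdiff_lip hf; have [D D0 [d2 d20 hd2]] := fdiff_lip hg.
have [e1 e10 he1] := exists_factor (normr_ge0 (f x t)) e3.
have [e2 e20 he2] := exists_factor (normr_ge0 (g x t)) e3.
have CD0 : 0 <= C * D * 2 by rewrite !mulr_ge0 // ltW.
have [d5 d50 hd5] := exists_factor CD0 e3.
have [d3 d30 hd3] := hf _ e20; have [d4 d40 hd4] := hg _ e10.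
have [|d d0 /and5P[h1 h2 h3 h4 /andP[h5 _]]] := @exists_lbound _ [:: d1; d2; d3; d4; d5].
  by rewrite /= d10 d20 d30 d40 d50.
exists d => // y s hy hs.
have {hd1}k1 := hd1 y s (lt_le_trans hy h1) (lt_le_trans hs h1).
have {hd2}k2 := hd2 y s (lt_le_trans hy h2) (lt_le_trans hs h2).
have {hd3}k3 := hd3 y s (lt_le_trans hy h3) (lt_le_trans hs h3).
have {hd4}k4 := hd4 y s (lt_le_trans hy h4) (lt_le_trans hs h4).
have {he1}k5 := he1 _ (ltW e10) (lexx _); have {he2}k6 := he2 _ (ltW e20) (lexx _).
have {hd5}k7 := hd5 d (ltW d0) h5.
set w := enorm (y - x) + `|s - t| in k1 k2 k3 k4 *.
have w0 : 0 <= w by rewrite addr_ge0.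
have wd : w <= 2 * d by rewrite /w; clear -hy hs; lra.
rewrite dotvDl !dotvZl.
set F := f y s - f x t in k1 k3; set G := g y s - g x t in k2 k4.
set df := dotv p _ + _ in k3; set dg := dotv q _ + _ in k4.
rewrite (_ : _ - _ = f x t * (G - dg) + g x t * (F - df) + F * G); last first.
  by rewrite /F /G /df /dg; ring.
have m1 : `|f x t * (G - dg)| <= e / 3 * w.
  rewrite normrM; apply: (le_trans (ler_wpM2l (normr_ge0 _) k4)).
  by rewrite mulrA ler_wpM2r.
have m2 : `|g x t * (F - df)| <= e / 3 * w.
  rewrite normrM; apply: (le_trans (ler_wpM2l (normr_ge0 _) k3)).
  by rewrite mulrA ler_wpM2r.
have m3 : `|F * G| <= e / 3 * w.
  rewrite normrM; apply: (le_trans (ler_pM (normr_ge0 _) (normr_ge0 _) k1 k2)).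
  rewrite mulrA ler_wpM2r //; apply: le_trans k7.
  rewrite (_ : C * w * D = C * D * w) -?mulrA; last by ring.
  by rewrite !ler_pM2l.
apply: (le_trans (ler_normD _ _)); apply: (le_trans (lerD (ler_normD _ _) (lexx _))).
by clear -m1 m2 m3; lra.
Qed.

(** The tangent lines at [a] and at [b] enclose the remainder between [0] and
    [(expR b - expR a) (b - a)]. *)
Lemma expR_secant (R : realType) (a b : R) :
  `|expR b - expR a - expR a * (b - a)| <= `|expR b - expR a| * `|b - a|.
Proof.
have c (x y : R) : expR x * (y - x) <= expR y - expR x.
  have := expR_ge1Dx (y - x); rewrite -(ler_pM2l (expR_gt0 x)) -expRD.
  by rewrite (addrC x) subrK; clear; lra.
have h1 := c a b; have h2 := c b a.
rewrite ger0_norm ?subr_ge0 // -normrM.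
by apply: le_trans (ler_norm _); clear -h1 h2; lra.
Qed.

Lemma fdiff_expR (R : realType) n (f : 'rV[R]_n -> R -> R) x t p a :
  fdiff f x t p a ->
  fdiff (fun y s => expR (f y s)) x t (expR (f x t) *: p) (expR (f x t) * a).
Proof.
move=> hf e e0; have e2 : 0 < e / 2 by rewrite divr_gt0.
have [C C0 [d1 d10 hd1]] := fdiff_lip hf.
have [e1 e10 he1] := exists_factor (expR_ge0 (f x t)) e2.
have [e3 e30 he3] := exists_factor (ltW C0) e2.
have [d2 d20 hd2] := expR_mul_cts 1 1 (f x t) e30.
have [d3 d30 hd3] := hf _ e10.
have [|d d0 /and4P[h1 h2 h3 _]] := @exists_lbound _ [:: d1; d2 / (2 * C); d3].
  by rewrite /= d10 d30 divr_gt0 // mulr_gt0.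
exists d => // y s hy hs.
have {hd1}k1 := hd1 y s (lt_le_trans hy h1) (lt_le_trans hs h1).
have {hd3}k3 := hd3 y s (lt_le_trans hy h3) (lt_le_trans hs h3).
have {he1}k5 := he1 _ (ltW e10) (lexx _); have {he3}k6 := he3 _ (ltW e30) (lexx _).
set w := enorm (y - x) + `|s - t| in k1 k3 *.
have w0 : 0 <= w by rewrite addr_ge0.
have fd : `|f y s - f x t| < d2.
  apply: (le_lt_trans k1); apply: (@lt_le_trans _ _ (C * (2 * d))).
    by rewrite ltr_pM2l // /w; clear -hy hs; lra.
  by move: h2; rewrite ler_pdivlMr ?mulr_gt0 //; clear; lra.
have := hd2 _ fd; rewrite !mul1r => k4.
have k7 := expR_secant (f x t) (f y s).
rewrite dotvZl (_ : _ - _ = (expR (f y s) - expR (f x t) - expR (f x t) * (f y s - f x t)) +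
  expR (f x t) * (f y s - f x t - (dotv p (y - x) + a * (s - t)))); last by ring.
have m1 : `|expR (f y s) - expR (f x t)| * `|f y s - f x t| <= e / 2 * w.
  apply: (le_trans (ler_pM (normr_ge0 _) (normr_ge0 _) (ltW k4) k1)).
  by rewrite mulrA ler_wpM2r // mulrC.
have m2 : `|expR (f x t) * (f y s - f x t - (dotv p (y - x) + a * (s - t)))| <= e / 2 * w.
  rewrite normrM (gtr0_norm (expR_gt0 _)).
  apply: (le_trans (ler_wpM2l (expR_ge0 _) k3)).
  by rewrite mulrA ler_wpM2r.
apply: (le_trans (ler_normD _ _)); clear -m1 m2 k7; lra.
Qed.

Lemma fdiff_snorm (R : realType) n (k : R) (a x : 'rV[R]_n) t : 0 < k ->
  fdiff (fun y _ => snorm k (y - a)) x t ((snorm k (x - a))^-1 *: (x - a)) 0.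
Proof.
move=> k0 e e0; exists (e * k) => [|y s hy hs]; first by rewrite mulr_gt0.
have := snorm_taylor (x - a) (y - a) k0; rewrite opprB addrA subrK mul0r addr0.
move=> h; apply: (le_trans h); rewrite ler_pdivrMr // expr2.
apply: (@le_trans _ _ (e * k * enorm (y - x))).
  by rewrite ler_wpM2r // ltW.
rewrite [leRHS]mulrAC ler_wpM2l ?lerDl //; by rewrite mulr_ge0 // ltW.
Qed.

Lemma fdiff_kquad (R : realType) n (kx kt : R) (a x : 'rV[R]_n) (b t : R) :
  fdiff (kquad kx kt a b) x t ((2 * kx) *: (x - a)) (2 * kt * (t - b)).
Proof.
move=> e e0.
have [d d0 hd] := exists_factor (addr_ge0 (normr_ge0 kx) (normr_ge0 kt)) e0.
exists d => // y s hy hs; rewrite (kquad_sub kx kt a x y b t s) dotvZl.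
rewrite (_ : _ - _ = kquad kx kt x t y s); last by ring.
have he := hd d (ltW d0) (lexx _).
have hX : `|kx| * enorm (y - x) <= e.
  by apply: le_trans he; rewrite ler_pM ?lerDl // ltW.
have hS : `|kt| * `|s - t| <= e.
  by apply: le_trans he; rewrite ler_pM ?lerDr // ltW.
apply: (le_trans (ler_normD _ _)); rewrite !expr2 !normrM (ger0_norm (enorm_ge0 _)).
by rewrite [leRHS]mulrDr !mulrA; apply: lerD; rewrite ler_wpM2r.
Qed.

Definition quadsup {R : realType} {n : nat} (T : R) (H : 'rV[R]_n -> R -> R -> 'rV[R]_n -> R)
    (u : 'rV[R]_n -> R -> R) : Prop :=
  forall (kx kt : R) (a : 'rV[R]_n) (b : R) (y : 'rV[R]_n) (s : R),
    0 < kx -> 0 < kt -> 0 < s < T ->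
    (exists2 d : R, 0 < d & forall (y' : 'rV[R]_n) (s' : R),
       enorm (y' - y) < d -> `|s' - s| < d ->
       u y s + kquad kx kt a b y s <= u y' s' + kquad kx kt a b y' s') ->
    0 <= - (2 * kt * (s - b)) + H y s (u y s) (- ((2 * kx) *: (y - a))).

(** * Doubling of variables *)

Lemma cvg_within_fst (R : realType) n (K : set ('rV[R]_n * R)) (f : 'rV[R]_n -> R -> R) Q :
  cts_on K f -> (K `*` K) Q ->
  (fun Q => f Q.1.1 Q.1.2) @ within (K `*` K) (nbhs Q) --> f Q.1.1 Q.1.2.
Proof.
move=> cf; case: Q => -[x t] w [/= Kx _]; apply/cvgrPdist_lt => e e0.
have [d d0 hd] := cf x t Kx e e0; rewrite near_withinE.
have h1 : \forall S \near nbhs ((x, t), w), enorm (S.1.1 - x) < d /\ `|S.1.2 - t| < d.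
  exact: (@cvg_fst _ _ (nbhs (x, t)) (nbhs w) _ _ (near_strip x t d0)).
apply: filterS h1 => -[[y s] w'] /= [h1 h2] [/= Ky _].
by rewrite distrC; exact: hd.
Qed.

Lemma cvg_within_snd (R : realType) n (K : set ('rV[R]_n * R)) (f : 'rV[R]_n -> R -> R) Q :
  cts_on K f -> (K `*` K) Q ->
  (fun Q => f Q.2.1 Q.2.2) @ within (K `*` K) (nbhs Q) --> f Q.2.1 Q.2.2.
Proof.
move=> cf; case: Q => w -[x t] [/= _ Kx]; apply/cvgrPdist_lt => e e0.
have [d d0 hd] := cf x t Kx e e0; rewrite near_withinE.
have h1 : \forall S \near nbhs (w, (x, t)), enorm (S.2.1 - x) < d /\ `|S.2.2 - t| < d.
  exact: (@cvg_snd _ _ (nbhs w) (nbhs (x, t)) _ _ (near_strip x t d0)).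
apply: filterS h1 => -[w' [y s]] /= [h1 h2] [/= _ Ky].
by rewrite distrC; exact: hd.
Qed.

Lemma doubling_max (R : realType) n (K : set ('rV[R]_n * R)) (f u : 'rV[R]_n -> R -> R)
    (kx kt : R) x0 t0 :
  compact K -> K (x0, t0) -> cts_on K f -> cts_on K u ->
  exists x t y s, [/\ K (x, t), K (y, s) & forall x' t' y' s', K (x', t') -> K (y', s') ->
    f x' t' - u y' s' - kquad kx kt x' t' y' s' <= f x t - u y s - kquad kx kt x t y s].
Proof.
move=> cK K0 cf cu.
have cKK : compact (K `*` K) by exact: compact_setX.
have [|[[x t] [y s]] [/= Kx Ky] hm] := compact_max cKK (conj K0 K0 : (K `*` K) ((x0, t0), (x0, t0)))
    (f := fun Q => f Q.1.1 Q.1.2 - u Q.2.1 Q.2.2 - kquad kx kt Q.1.1 Q.1.2 Q.2.1 Q.2.2).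
  move=> Q KQ; apply: cvgB.
    by apply: cvgB; [exact: cvg_within_fst | exact: cvg_within_snd].
  apply: cvg_within_filter.
  have f1 : (fun Q : ('rV[R]_n * R) * ('rV[R]_n * R) => Q.1) @ nbhs Q --> Q.1 by exact: cvg_fst.
  have f2 : (fun Q : ('rV[R]_n * R) * ('rV[R]_n * R) => Q.2) @ nbhs Q --> Q.2 by exact: cvg_snd.
  have h1 : (fun Q : ('rV[R]_n * R) * ('rV[R]_n * R) => enorm (Q.2.1 - Q.1.1)) @ nbhs Q -->
      enorm (Q.2.1 - Q.1.1).
    apply: enorm_sub_cvg; first exact: (cvg_comp _ _ f2 cvg_fst).
    exact: (cvg_comp _ _ f1 cvg_fst).
  have h2 : (fun Q : ('rV[R]_n * R) * ('rV[R]_n * R) => Q.2.2 - Q.1.2) @ nbhs Q -->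
      Q.2.2 - Q.1.2.
    apply: cvgB; first exact: (cvg_comp _ _ f2 cvg_snd).
    exact: (cvg_comp _ _ f1 cvg_snd).
  exact: (cvgD (cvgM (cvg_cst kx) (cvgM h1 h1)) (cvgM (cvg_cst kt) (cvgM h2 h2))).
exists x, t, y, s; split=> // x' t' y' s' Kx' Ky'.
exact: (hm ((x', t'), (y', s')) (conj Kx' Ky')).
Qed.

Lemma fdiff_cts (R : realType) n (K : set ('rV[R]_n * R)) (f : 'rV[R]_n -> R -> R) :
  (forall x t, exists p tau, fdiff f x t p tau) -> cts_on K f.
Proof.
move=> hf x t _ e e0; have [p [tau h]] := hf x t.
have [C C0 [d d0 hd]] := fdiff_lip h.
have [|c c0 /and3P[h1 h2 _]] := @exists_lbound _ [:: d; e / (2 * C)].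
  by rewrite /= d0 divr_gt0 // mulr_gt0.
exists c => // y s _ hy hs.
apply: (le_lt_trans (hd y s (lt_le_trans hy h1) (lt_le_trans hs h1))).
apply: (@lt_le_trans _ _ (C * (2 * c))); first by rewrite ltr_pM2l //; clear -hy hs; lra.
by move: h2; rewrite ler_pdivlMr ?mulr_gt0 //; clear; lra.
Qed.

Lemma cts_on_bounded (R : realType) n (K : set ('rV[R]_n * R)) (f : 'rV[R]_n -> R -> R) :
  compact K -> cts_on K f -> exists2 M, 0 <= M & forall x t, K (x, t) -> `|f x t| <= M.
Proof.
move=> cK cf; have [[Q KQ]|nK] := pselect (exists Q, K Q).
  have [|[x t] Kx hm] := compact_max cK KQ (f := fun Q => `|f Q.1 Q.2|).
    by move=> S KS; apply: cvg_norm; exact: cts_on_cvg.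
  by exists `|f x t| => // y s Ky; exact: (hm (y, s)).
by exists 0 => // x t Kx; case: nK; exists (x, t).
Qed.

Lemma cts_onD (R : realType) n (K : set ('rV[R]_n * R)) (f g : 'rV[R]_n -> R -> R) :
  cts_on K f -> cts_on K g -> cts_on K (fun x t => f x t + g x t).
Proof.
move=> cf cg x t Kx e e0; have e2 : 0 < e / 2 by rewrite divr_gt0.
have [d1 d10 hd1] := cf x t Kx _ e2; have [d2 d20 hd2] := cg x t Kx _ e2.
have [|d d0 /and3P[h1 h2 _]] := @exists_lbound _ [:: d1; d2]; first by rewrite /= d10 d20.
exists d => // y s Ky hy hs.
have := hd1 y s Ky (lt_le_trans hy h1) (lt_le_trans hs h1).
have := hd2 y s Ky (lt_le_trans hy h2) (lt_le_trans hs h2).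
by rewrite !ltr_norml; clear; lra.
Qed.

Lemma cts_onN (R : realType) n (K : set ('rV[R]_n * R)) (f : 'rV[R]_n -> R -> R) :
  cts_on K f -> cts_on K (fun x t => - f x t).
Proof.
move=> cf x t Kx e e0; have [d d0 hd] := cf x t Kx e e0; exists d => // y s Ky hy hs.
by rewrite -opprD normrN; exact: hd.
Qed.

(** The time slope [m tauo] of the weight absorbs both the (H2)-error caused by [m po] and [K3 m om]
    from (H3), leaving one [m om]; [g] pays for itself and for [c] by its differential inequality.
    The [3 eta] are the errors in value, space and time. *)
Lemma comparison_bound (R : realType) n T (H : 'rV[R]_n -> R -> R -> 'rV[R]_n -> R)
    (C1 beta A2 B2 K3 : R) (HH : hamiltonian T H C1 beta A2 B2 K3)
    (x y p po : 'rV[R]_n) (t s vx ux uy g g' c om tauo tau m nu eta : R) :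
  0 <= t <= T -> 0 <= s <= T ->
  m * tauo - g' + tau + H x t vx (p + m *: po) <= c -> 0 <= tau + H y s uy p ->
  0 <= m -> 0 <= om -> 0 <= g -> (A2 * enorm x + B2) * enorm po + (K3 + 1) * om <= tauo ->
  g' + K3 * g + c <= 0 ->
  `|vx - ux + g - m * om| <= nu -> `|ux - uy| <= nu ->
  K3 * (2 * nu) <= eta -> C1 * (beta + enorm p) * enorm (x - y) <= eta ->
  `|H y s uy p - H y t uy p| <= eta -> m * om <= 3 * eta.
Proof.
move=> tT sT hv hu m0 om0 g0 ho hg hF huu hK hx ht.
have K30 := ham_K3 HH.
have a1 := ham_p HH x vx (p + m *: po) p tT.
have {}a1 : `|H x t vx (p + m *: po) - H x t vx p| <= m * ((A2 * enorm x + B2) * enorm po).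
  by apply: (le_trans a1); rewrite (addrC p) addrK enormZ ger0_norm // mulrCA.
have a2 : `|H x t vx p - H x t uy p| <= K3 * (m * om + g + 2 * nu).
  apply: (le_trans (ham_u HH _ _ _ _ tT)); rewrite ler_wpM2l //.
  have mo : 0 <= m * om by rewrite mulr_ge0.
  by move: hF huu; rewrite !ler_norml; clear -g0 mo; lra.
have a3 := le_trans (ham_x HH x y uy p tT) hx.
have a4 := ler_wpM2l m0 ho.
move: a1 a2 a3 ht; rewrite !ler_norml => a1 a2 a3 ht.
clear -a1 a2 a3 a4 ht hK hg hv hu; lra.
Qed.

(** Points where [F] is close to its maximum [0] are interior, so one fixed large penalty, with no
    passage to the limit, places both doubled points there. The resulting [m om <= 3 eta]
    contradicts the assumed [4 eta]. *)
Lemma comparison_contact (R : realType) n T (H : 'rV[R]_n -> R -> R -> 'rV[R]_n -> R)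
    (C1 beta A2 B2 K3 : R) (HH : hamiltonian T H C1 beta A2 B2 K3)
    (u v om : 'rV[R]_n -> R -> R) (g g' c : R -> R) (xb xs : 'rV[R]_n) (ts r t1 m c0 eta : R) :
  let K := cyl xb r 0 t1 in let F := fun x t => v x t - u x t + g t - m * om x t in
  cts_on K u -> cts_on K v -> quadsup T H u ->
  (forall x t p tau, 0 < t < T -> fsub (fun y s => - v y s) x t (- p) (- tau) ->
     tau + H x t (v x t) p <= c t) ->
  (forall x t, fdiff (fun (y : 'rV[R]_n) s => g s) x t 0 (g' t)) ->
  (forall t, g' t + K3 * g t + c t <= 0) -> (forall t, 0 <= t <= t1 -> 0 <= g t) ->
  (forall x t, exists p tau, fdiff om x t p tau /\
     (A2 * enorm x + B2) * enorm p + (K3 + 1) * om x t <= tau) ->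
  (forall x t, 0 < om x t) -> 0 < m -> t1 < T -> 0 < c0 -> 0 < eta ->
  (forall x t, K (x, t) -> 4 * eta <= m * om x t) ->
  (forall x t, K (x, t) -> F x t <= 0) -> K (xs, ts) -> F xs ts = 0 ->
  (forall x t, K (x, t) -> - c0 < F x t -> [/\ 0 < t, t < t1 & enorm (x - xb) < r]) ->
  False.
Proof.
move=> K F cu cv qs hv hg hgc g0 hom om0 m0 t1T c00 eta0 hmo Fle Ks Fs hb.
have C10 := ham_C1 HH; have be0 := ham_beta HH; have K30 := ham_K3 HH.
have cK : compact K by exact: cyl_compact.
have com : cts_on K om by apply: fdiff_cts => x t; have [p [tau [h _]]] := hom x t; exists p, tau.
have cg : cts_on K (fun _ s => g s) by apply: fdiff_cts => x t; exists 0, (g' t).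
have cmo : cts_on K (fun x t => m * om x t).
  apply: fdiff_cts => x t; have [p [tau [h _]]] := hom x t.
  by eexists; eexists; exact: fdiffM (fdiff_cst m x t) h.
have cf : cts_on K (fun x t => v x t + g t + - (m * om x t)).
  by apply: cts_onD; [exact: cts_onD | exact: cts_onN].
have cF : cts_on K (fun x t => v x t + g t + - (m * om x t) + - u x t).
  by apply: cts_onD => //; exact: cts_onN.
have [nu [nu0 nuc nuK nuC]] : exists nu, [/\ 0 < nu, 2 * nu < c0, K3 * (2 * nu) <= eta &
    2 * C1 * nu <= eta / 2].
  have [a a0 ha] := exists_factor (mulr_ge0 K30 (ler0n R 2)) eta0.
  have [b b0 hb'] := exists_factor (mulr_ge0 (ler0n R 2) C10) (divr_gt0 eta0 (ltr0n R 2)).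
  have [|d d0 /and4P[h1 h2 h3 _]] := @exists_lbound _ [:: c0 / 4; a; b].
    by rewrite /= a0 b0 divr_gt0.
  exists d; split=> //; first by clear -h1 c00; lra.
    by rewrite mulrA; exact: ha (ltW d0) h2.
  exact: hb' (ltW d0) h3.
have [M M0 hM] := cts_on_bounded cK cu.
have [d1 d10 hd1] := unif_cts_on cK cu nu0.
have [d2 d20 hd2] := unif_cts_on cK cF nu0.
have [d3 d30 hd3] := exists_factor (mulr_ge0 C10 be0) (divr_gt0 eta0 (ltr0n R 2)).
have [|rho1 rho10 /and4P[r11 r12 r13 _]] := @exists_lbound _ [:: d1; d2; d3].
  by rewrite /= d10 d20 d30.
(* At the doubled maximum the penalty is at most [F x t + u x t - u y s <= 2 M], since
   [F xs ts = 0]; the [+ 1] makes the bound strict. *)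
have ex_k rho : 0 < rho -> exists2 k, 0 < k & 2 * M + 1 <= k * rho ^+ 2.
  move=> h; exists ((2 * M + 1) / rho ^+ 2).
    by rewrite divr_gt0 ?exprn_gt0 // ltr_wpDl ?mulr_ge0.
  by rewrite divfK // gt_eqF // exprn_gt0.
have [kx kx0 hkx] := ex_k _ rho10.
have [rho2 rho20 hrho2] := @hamiltonian_unif_time _ _ _ H xb r 0 t1
  M (2 * kx * rho1) (ham_cont HH) (lexx 0) (ltW t1T) eta eta0.
have [|rho3 rho30 /and3P[r31 r32 _]] := @exists_lbound _ [:: rho1; rho2].
  by rewrite /= rho10 rho20.
have [kt kt0 hkt] := ex_k _ rho30.
(* The weight and [g] are carried by the first point alone, so that [u] at the second is tested by a
   bare quadratic, as [quadsup] requires. *)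
have [x [t [y [s [Kx Ky hmax]]]]] := doubling_max kx kt cK Ks cf cu.
have hge : kquad kx kt x t y s <= F x t + u x t - u y s.
  have := hmax _ _ _ _ Ks Ks; rewrite kquad_diag; move: Fs; rewrite /F; clear; lra.
have kq0 := kquad_ge0 x t y s (ltW kx0) (ltW kt0).
have kqM : kquad kx kt x t y s < 2 * M + 1.
  have := hM _ _ Kx; have := hM _ _ Ky; have := Fle _ _ Kx.
  by rewrite !ler_norml; clear -hge; lra.
have [yx st] := kquad_lt kx0 kt0 rho10 rho30 hkx hkt kqM.
have uu : `|u y s - u x t| < nu.
  by apply: hd1 => //; [exact: lt_le_trans r11 | apply: lt_le_trans r11; exact: lt_le_trans r31].
have FF : `|F y s - F x t| < nu.
  have := hd2 _ _ _ _ Kx Ky (lt_le_trans yx r12) (lt_le_trans st (le_trans r31 r12)).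
  rewrite (_ : _ - _ = F y s - F x t) //; rewrite /F; ring.
have kqn : kquad kx kt x t y s <= nu.
  by have := Fle _ _ Kx; move: uu; rewrite ltr_norml; clear -hge; lra.
have Fx : - nu <= F x t by move: uu; rewrite ltr_norml; clear -hge kq0; lra.
have [tx0 tx1 xr] : [/\ 0 < t, t < t1 & enorm (x - xb) < r].
  by apply: hb => //; clear -Fx nuc nu0; lra.
have [sy0 sy1 yr] : [/\ 0 < s, s < t1 & enorm (y - xb) < r].
  by apply: hb => //; move: FF; rewrite ltr_norml; clear -Fx nuc nu0; lra.
have inK z w : 0 < w -> w < t1 -> enorm (z - xb) < r -> exists2 d, 0 < d &
    forall z' w', enorm (z' - z) < d -> `|w' - w| < d -> K (z', w').
  move=> w0 w1 zr; have [|d d0 /and4P[h1 h2 h3 _]] :=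
      @exists_lbound _ [:: w; t1 - w; r - enorm (z - xb)].
    by rewrite /= w0 !subr_gt0 w1 zr.
  exists d => // z' w' hz; rewrite ltr_norml => hw; split=> /=.
    by have := enorm_dist z' z xb; clear -hz h3; lra.
  by clear -hw h1 h2; lra.
set p := - ((2 * kx) *: (y - x)); set tau := - (2 * kt * (s - t)).
have hsup : 0 <= tau + H y s (u y s) p.
  apply: qs => //; first by rewrite sy0 (lt_trans sy1).
  have [d d0 hd] := inK y s sy0 sy1 yr; exists d => // y' s' hy' hs'.
  by have := hmax _ _ _ _ Kx (hd _ _ hy' hs'); clear; lra.
have [po [tauo [hdo ho]]] := hom x t.
have kqC x' t' : kquad kx kt x' t' y s = kquad kx kt y s x' t'.
  by rewrite /kquad enorm_subC -(sqrrN (s - t')) opprB.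
have hsub : m * tauo - g' t + tau + H x t (v x t) (p + m *: po) <= c t.
  apply: hv; first by rewrite tx0 (lt_trans tx1).
  have fG := fdiffD (fdiffD (fdiffM (fdiff_cst m x t) hdo)
     (fdiffM (fdiff_cst (-1) x t) (hg x t))) (fdiff_kquad kx kt y x s t).
  move=> e e0; have [d' d'0 hd'] := fG e e0.
  have [d'' d''0 hd''] := inK x t tx0 tx1 xr.
  have [|d d0 /and3P[h1 h2 _]] := @exists_lbound _ [:: d'; d'']; first by rewrite /= d'0 d''0.
  exists d => // x' t' hx' ht'.
  have := hmax _ _ _ _ (hd'' _ _ (lt_le_trans hx' h2) (lt_le_trans ht' h2)) Ky.
  rewrite !kqC.
  have := hd' _ _ (lt_le_trans hx' h1) (lt_le_trans ht' h1).
  rewrite !(scaler0, addr0, mulr0) ler_norml => /andP[_].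
  have -> : - (p + m *: po) = - (m *: po + (2 * kx) *: (x - y)).
    by rewrite /p addrC -scalerN opprB.
  rewrite dotvNl /tau; clear; lra.
have pe : enorm p = 2 * kx * enorm (y - x).
  by rewrite enormN enormZ gtr0_norm // mulr_gt0.
have t0T : 0 <= t <= T by rewrite (ltW tx0) ltW // (lt_trans tx1).
have s0T : 0 <= s <= T by rewrite (ltW sy0) ltW // (lt_trans sy1).
suff : m * om x t <= 3 * eta by have := hmo _ _ Kx; clear -eta0; lra.
have gt0 : 0 <= g t by apply: g0; rewrite (ltW tx0) ltW.
apply: (comparison_bound HH t0T s0T hsub hsup (ltW m0) (ltW (om0 x t)) gt0 ho (hgc t)
  (nu := nu) (ux := u x t) _ _ nuK).
- by rewrite ler_norml Fx /= (le_trans (Fle _ _ Kx)) // ltW.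
- by rewrite distrC ltW.
- rewrite enorm_subC mulrDr mulrDl.
  have b1 : C1 * beta * enorm (y - x) <= eta / 2.
    by apply: hd3 => //; apply: le_trans r13; exact: ltW.
  have b2 : C1 * enorm p * enorm (y - x) <= eta / 2.
    apply: le_trans nuC; rewrite pe.
    rewrite (_ : _ * _ * _ = 2 * C1 * (kx * enorm (y - x) ^+ 2)); last by ring.
    rewrite ler_wpM2l ?mulr_ge0 //; apply: le_trans kqn.
    by rewrite lerDl mulr_ge0 ?sqr_ge0 // ltW.
  by clear -b1 b2; lra.
- apply: ltW; apply: hrho2; rewrite ?(ltW yr) ?(ltW sy0) ?(ltW sy1) ?(ltW tx0) ?(ltW tx1) //.
  + exact: hM.
  + by rewrite pe ler_pM2l ?mulr_gt0 // ltW.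
  + exact: lt_le_trans r32.
Qed.

(** * Viscosity solutions tested by quadratics *)

Lemma kquad_C1 (R : realType) n T (kx kt : R) (a : 'rV[R]_n) (b : R) :
  C1_strip T (kquad kx kt a b) (fun x _ => (2 * kx) *: (x - a)) (fun _ t => 2 * kt * (t - b)).
Proof.
move=> x t _ e e0.
have [d1 d10 hd1] := fdiff_kquad kx kt a x b t e0.
have e2 : 0 < e / 2 by rewrite divr_gt0.
have [d2 d20 hd2] := exists_factor (normr_ge0 (2 * kx)) e2.
have [d3 d30 hd3] := exists_factor (normr_ge0 (2 * kt)) e2.
have [|d d0 /and4P[h1 h2 h3 _]] := @exists_lbound _ [:: d1; d2; d3].
  by rewrite /= d10 d20 d30.
exists d => // y s _ hy hs; split.
- have := hd1 y s (lt_le_trans hy h1) (lt_le_trans hs h1).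
  by apply: le_trans; rewrite le_eqVlt; apply/orP; left; apply/eqP; congr (`|_|); ring.
- rewrite -scalerBr opprB addrA subrK enormZ.
  apply: (@le_lt_trans _ _ (e / 2)); last by clear -e0; lra.
  by apply: hd2 => //; apply: le_trans h2; exact: ltW.
- rewrite -mulrBr opprB addrA subrK normrM.
  apply: (@le_lt_trans _ _ (e / 2)); last by clear -e0; lra.
  by apply: hd3 => //; apply: le_trans h3; exact: ltW.
Qed.

Lemma visc_sol_quadsub (R : realType) n T H (u0 : 'rV[R]_n -> R) (u : 'rV[R]_n -> R -> R) :
  visc_sol T H u0 u -> quadsub T H u.
Proof.
move=> [_ _ hu] kx kt a b y s _ _ sT [d d0 hd].
have [h _] := hu _ _ _ (@kquad_C1 R n T kx kt a b) y s sT; apply: h.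
by exists d => // y' s' _; exact: hd.
Qed.

(** A minimum of [u + kquad] is a contact from below with [kquad] of negated weights, which
    [kquad_C1] covers as well. *)
Lemma visc_sol_quadsup (R : realType) n T H (u0 : 'rV[R]_n -> R) (u : 'rV[R]_n -> R -> R) :
  visc_sol T H u0 u -> quadsup T H u.
Proof.
move=> [_ _ hu] kx kt a b y s _ _ sT [d d0 hd].
have [_ h] := hu _ _ _ (@kquad_C1 R n T (- kx) (- kt) a b) y s sT.
have kN y' s' : kquad (- kx) (- kt) a b y' s' = - kquad kx kt a b y' s'.
  by rewrite /kquad; ring.
have -> : - (2 * kt * (s - b)) = 2 * - kt * (s - b) by ring.
rewrite -scaleNr -mulrN; apply: h.
by exists d => // y' s' _ hy hs; rewrite !kN !opprK; exact: hd.
Qed.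

(** * Comparison in backward cones *)

Lemma fdiff_Rfun (R : realType) n (A2 B2 : R) (xb x : 'rV[R]_n) t : 0 <= A2 ->
  fdiff (fun (_ : 'rV[R]_n) s => Rfun A2 B2 xb s) x t 0 ((B2 + A2 * enorm xb) * expR (A2 * t)).
Proof.
rewrite /Rfun le0r => /orP[/eqP->|A0].
  rewrite ltxx !mul0r expR0 addr0 mulr1; exact: fdiff_time.
rewrite A0.
have := fdiffM (fdiff_cst (B2 / A2 + enorm xb) x t)
  (fdiffD (fdiff_expR (fdiff_time A2 x t)) (fdiff_cst (-1) x t)).
rewrite !(scaler0, addr0, mulr0).
by rewrite (_ : _ * (_ * _) = (B2 + A2 * enorm xb) * expR (A2 * t)) //; field; rewrite gt_eqF.
Qed.

Lemma Rfun0 (R : realType) n (A2 B2 : R) (x : 'rV[R]_n) : Rfun A2 B2 x 0 = 0.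
Proof. by rewrite /Rfun !mulr0 expR0 subrr mulr0; case: ifP. Qed.

Lemma Rfun_mono (R : realType) n (A2 B2 : R) (x : 'rV[R]_n) s t : 0 <= A2 -> 0 <= B2 ->
  s <= t -> Rfun A2 B2 x s <= Rfun A2 B2 x t.
Proof.
move=> A20 B20 st; rewrite /Rfun; case: ifP => A0; last by rewrite ler_wpM2l.
by rewrite ler_wpM2l ?addr_ge0 ?divr_ge0 // lerD2r ler_expR ler_wpM2l.
Qed.

(** In [t], [Rfun] solves [R' = A2 R + A2 |xb| + B2] from [0]: it is a bound for the distance from
    [xb] covered at speed [A2 |x| + B2]. For [mu = k = 0] the level set through [(xb, tb)] is the
    backward cone [|x - xb| = Rfun A2 B2 xb (tb - t)]; [k] makes the function differentiable on the
    axis. *)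
Definition cone {R : realType} {n : nat} (A2 B2 mu k : R) (xb x : 'rV[R]_n) (t : R) : R :=
  expR (A2 * t) * snorm k (x - xb) + Rfun A2 B2 xb t + mu * t.

(* The sublevel sets of [cone] shrink forward in time at least at the speed [A2 |x| + B2] that
   (H2) allows, and the excess [mu] leaves room for the zeroth-order term. *)
Lemma cone_weight (R : realType) n (A2 B2 K3 mu k N z : R) (xb : 'rV[R]_n) :
  0 <= A2 -> 0 <= B2 -> 0 < k -> 0 <= N -> K3 + 1 <= N * mu -> forall x t,
  let om := fun y s => expR (N * (cone A2 B2 mu k xb y s + z)) in
  exists p tau, fdiff om x t p tau /\
     (A2 * enorm x + B2) * enorm p + (K3 + 1) * om x t <= tau.
Proof.
move=> A20 B20 k0 N0 hN x t om.
have h1 := fdiffM (fdiff_expR (fdiff_time A2 x t)) (fdiff_snorm xb x t k0).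
have h2 := fdiffD (fdiffD h1 (fdiff_Rfun B2 xb x t A20)) (fdiff_time mu x t).
have h3 := fdiff_expR (fdiffM (fdiff_cst N x t) (fdiffD h2 (fdiff_cst z x t))).
eexists; eexists; split; first exact: h3.
rewrite !(scaler0, addr0, mulr0, add0r) -/(om x t) !enormZ.
set w := snorm k (x - xb).
have w0 : 0 < w by apply: lt_le_trans (snorm_ge _ (ltW k0)).
rewrite normfV (gtr0_norm w0) (ger0_norm N0) !(gtr0_norm (expR_gt0 _)).
set E := expR (A2 * t); set O := om x t.
have wle : enorm (x - xb) <= w by exact: enorm_le_snorm.
have O0 : 0 < O by exact: expR_gt0.
have E0 : 0 < E by exact: expR_gt0.
have xle : A2 * enorm x <= A2 * (w + enorm xb).
  by rewrite ler_wpM2l //; have := enormD (x - xb) xb; rewrite subrK; clear -wle; lra.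
have p1 : w^-1 * enorm (x - xb) <= 1 by rewrite mulrC ler_pdivrMr // mul1r.
have p0 : 0 <= w^-1 * enorm (x - xb) by rewrite mulr_ge0 // invr_ge0 ltW.
set q := w^-1 * enorm (x - xb) in p0 p1 *.
have s1 : (A2 * enorm x + B2) * (E * q) <= E * (A2 * (w + enorm xb) + B2).
  have a0 : 0 <= A2 * enorm x + B2 by rewrite addr_ge0 // mulr_ge0.
  rewrite [leRHS]mulrC; apply: ler_pM => //; first exact: mulr_ge0 (ltW E0) p0.
    by rewrite lerD2r.
  by rewrite -[leRHS]mulr1 ler_pM2l.
have s2 := ler_wpM2l (mulr_ge0 (ltW O0) N0) s1.
have s3 := ler_wpM2l (ltW O0) hN.
rewrite (_ : expR (N * (cone A2 B2 mu k xb x t + z)) = O) //; clear -s2 s3; lra.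
Qed.

(* Doubling of variables against the weight [exp (N (cone - cone at (xb, tb)))]: it is [1] at
   [(xb, tb)] and, for [N] large, dominates [v + g - u] on the lateral and upper boundary. *)
Lemma comparison (R : realType) n T (H : 'rV[R]_n -> R -> R -> 'rV[R]_n -> R)
    (C1 beta A2 B2 K3 : R) (HH : hamiltonian T H C1 beta A2 B2 K3)
    (u v : 'rV[R]_n -> R -> R) (g g' c : R -> R) (xb : 'rV[R]_n) (tb t1 rad : R) :
  cts_on [set Q | 0 <= Q.2 < T] u -> cts_on [set Q | 0 <= Q.2 < T] v -> quadsup T H u ->
  (forall x t p tau, 0 < t < T -> fsub (fun y s => - v y s) x t (- p) (- tau) ->
     tau + H x t (v x t) p <= c t) ->
  (forall x t, fdiff (fun (y : 'rV[R]_n) s => g s) x t 0 (g' t)) ->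
  (forall t, g' t + K3 * g t + c t <= 0) -> (forall t, 0 <= t <= t1 -> 0 <= g t) ->
  0 < tb -> tb < t1 -> t1 < T -> Rfun A2 B2 xb tb < rad ->
  (forall x, enorm (x - xb) <= rad -> v x 0 + g 0 <= u x 0) ->
  v xb tb + g tb <= u xb tb.
Proof.
move=> cu cv qs hv hg hgc g0 tb0 tb1 t1T hrad hbot.
rewrite leNgt; apply/negP => hlt.
have A20 := ham_A2 HH; have B20 := ham_B2 HH; have K30 := ham_K3 HH.
pose w0 x t := v x t - u x t + g t.
have [eta0 eta00 etaE] : exists2 eta0, 0 < eta0 & w0 xb tb = eta0.
  by eexists; last reflexivity; rewrite /w0; clear -hlt; lra.
(* The slack [sg] pays at most a quarter each for the smoothing [k], the drift [mu] and the margin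
   [s1], so that the radius [r = zb + s1] stays below [rad]. *)
have [sg sg0 sgE] : exists2 sg, 0 < sg & sg = rad - Rfun A2 B2 xb tb.
  by eexists; last reflexivity; rewrite subr_gt0.
have [k k0 hk] : exists2 k, 0 < k & expR (A2 * tb) * k = sg / 4.
  exists (sg / 4 / expR (A2 * tb)); first by rewrite !divr_gt0 // expR_gt0.
  by rewrite mulrC divfK // gt_eqF // expR_gt0.
have [mu mu0 hmu] : exists2 mu, 0 < mu & mu * tb = sg / 4.
  by exists (sg / 4 / tb); rewrite ?divr_gt0 // divfK // gt_eqF.
pose Z := cone A2 B2 mu k xb.
(* The second bound makes the cone at time [t1] exceed its value at [(xb, tb)] by [s1]; on the
   lateral boundary the choice of [r] does this. *)
have [|s1 s10 /and3P[s1a s1b _]] := @exists_lbound _ [:: sg / 4; mu * (t1 - tb)].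
  by rewrite /= divr_gt0 // mulr_gt0 // subr_gt0.
have [zb zbE] : exists zb, zb = Z xb tb by exists (Z xb tb).
have zb2 : zb = sg / 4 + Rfun A2 B2 xb tb + sg / 4.
  by rewrite zbE /Z /cone subrr snorm0 ?(ltW k0) // hk hmu.
have R0 t : 0 <= t -> 0 <= Rfun A2 B2 xb t.
  by move=> t0; rewrite -(Rfun0 A2 B2 xb); exact: Rfun_mono.
have [r rE] : exists r, r = zb + s1 by exists (zb + s1).
have rr : r <= rad by have := R0 _ (ltW tb0); clear -rE zb2 s1a sgE sg0; lra.
have r0 : 0 < r by have := R0 _ (ltW tb0); clear -rE zb2 s10 sg0; lra.
pose K := cyl xb r 0 t1.
have cK : compact K by exact: cyl_compact.
have KT : K `<=` [set Q | 0 <= Q.2 < T].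
  by move=> [x t] [/= _ /andP[h1 h2]]; rewrite h1 (le_lt_trans h2).
have cuK := cts_onS KT cu; have cvK := cts_onS KT cv.
have cgK : cts_on K (fun _ s => g s) by apply: fdiff_cts => x t; exists 0, (g' t).
have cw : cts_on K w0 by apply: cts_onD => //; apply: cts_onD => //; exact: cts_onN.
have [M M0 hM] := cts_on_bounded cK cw.
(* [N1] serves the differential inequality of the weight, [N2] the boundary: there [om >= 1 + N s1],
   so [m om] is at least [M + eta0]. *)
have [N [N0 N1 N2]] : exists N, [/\ 0 <= N, K3 + 1 <= N * mu & M <= N * (s1 * eta0)].
  have se : 0 < s1 * eta0 by rewrite mulr_gt0.
  have K31 : 0 <= K3 + 1 by rewrite addr_ge0.
  exists ((K3 + 1) / mu + M / (s1 * eta0)); split.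
  - by rewrite addr_ge0 // divr_ge0 // ltW.
  - by rewrite mulrDl divfK ?gt_eqF // lerDl mulr_ge0 ?divr_ge0 // ltW.
  - by rewrite mulrDl divfK ?gt_eqF // lerDr mulr_ge0 ?divr_ge0 // ltW.
pose om y s := expR (N * (Z y s + - zb)).
have hom x t : exists p tau, fdiff om x t p tau /\
    (A2 * enorm x + B2) * enorm p + (K3 + 1) * om x t <= tau.
  exact: cone_weight.
have om0 x t : 0 < om x t by exact: expR_gt0.
have com : cts_on K om.
  by apply: fdiff_cts => x t; have [p [tau [h _]]] := hom x t; exists p, tau.
have omb : om xb tb = 1 by rewrite /om -zbE subrr mulr0 expR0.
have Kb : K (xb, tb) by split=> /=; rewrite ?subrr ?enorm0 ?(ltW r0) // (ltW tb0) ltW.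
have [|[xs ts] Ks hms] := compact_max cK Kb (f := fun Q => w0 Q.1 Q.2 / om Q.1 Q.2).
  move=> Q KQ; apply: cvgM; first exact: (cts_on_cvg cw).
  by apply: cvgV; [rewrite gt_eqF | exact: (cts_on_cvg com)].
rewrite /= in hms.
(* As the largest quotient, [m] makes [w0 - m om] nonpositive on [K] and zero at [(xs, ts)]. *)
pose m := w0 xs ts / om xs ts.
have mge : eta0 <= m by have := hms (xb, tb) Kb; rewrite /= omb divr1 etaE.
have m0 : 0 < m by exact: lt_le_trans mge.
have Z0 x t : 0 <= t -> enorm (x - xb) <= Z x t.
  move=> t0; rewrite /Z /cone.
  have E1 : 1 <= expR (A2 * t) by rewrite -expR0 ler_expR mulr_ge0.
  have h1 := ler_wpM2r (snorm_ge0 k (x - xb)) E1.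
  have h2 := R0 _ t0; have h3 := mulr_ge0 (ltW mu0) t0.
  by have := enorm_le_snorm k (x - xb); clear -h1 h2 h3; lra.
have ombig x t : K (x, t) -> zb + s1 <= Z x t -> w0 x t - m * om x t <= - eta0.
  move=> Kx hZ.
  have o1 : 1 + N * s1 <= om x t.
    apply: (le_trans (expR_ge1Dx _)); rewrite ler_expR ler_wpM2l //.
    by clear -hZ; lra.
  have o2 : eta0 * (1 + N * s1) <= m * om x t.
    by apply: ler_pM => //; [exact: ltW | rewrite addr_ge0 // mulr_ge0 // ltW].
  by have := le_trans (ler_norm _) (hM _ _ Kx); clear -o2 N2; lra.
pose omin := expR (- (N * zb)).
have omin0 : 0 < omin by exact: expR_gt0.
have hmin x t : K (x, t) -> omin <= om x t.
  move=> [/= _ /andP[t0 _]]; rewrite ler_expR -mulrN ler_wpM2l //.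
  by have := le_trans (enorm_ge0 _) (Z0 x t t0); clear; lra.
(* At time [0], [w0 <= 0] leaves at most [- m omin]; on the rest of the boundary the value is at
   most [- eta0]. *)
have [|c0 c00 /and3P[c01 c02 _]] := @exists_lbound _ [:: m * omin; eta0].
  by rewrite /= eta00 mulr_gt0.
have moK x t : K (x, t) -> m * omin <= m * om x t by move=> /hmin h; rewrite ler_pM2l.
have me0 : 0 < m * omin / 4 by rewrite divr_gt0 // mulr_gt0.
apply: (comparison_contact HH (u := u) (v := v) (om := om) (g := g) (g' := g') (c := c)
  (xb := xb) (xs := xs) (ts := ts) (r := r) (t1 := t1) (m := m) (c0 := c0)
  (eta := m * omin / 4)) => //.
- by move=> x t /moK; clear; lra.
- move=> x t Kx; rewrite -/(w0 x t) subr_le0 -ler_pdivrMr //; exact: (hms (x, t)).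
- by rewrite -/(w0 xs ts) /m divfK ?subrr // gt_eqF.
move=> x t Kx; rewrite -/(w0 x t) => hF.
have [/= xr /andP[t0 tt1]] := Kx.
split.
- rewrite lt_neqAle t0 andbT; apply/eqP => tE; rewrite -tE in hF Kx.
  have hb : w0 x 0 <= 0 by have := hbot x (le_trans xr rr); rewrite /w0; clear; lra.
  by have := moK _ _ Kx; clear -hF hb c01; lra.
- rewrite lt_neqAle tt1 andbT; apply/eqP => tE; rewrite tE in hF Kx.
  have : w0 x t1 - m * om x t1 <= - eta0.
    apply: ombig => //; rewrite zbE /Z /cone.
    have h1 : expR (A2 * tb) * snorm k (xb - xb) <= expR (A2 * t1) * snorm k (x - xb).
      apply: ler_pM; rewrite ?snorm_ge0 ?expR_ge0 // ?subrr ?snorm0 ?(ltW k0) //.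
        by rewrite ler_expR ler_wpM2l // ltW.
      by apply: snorm_ge; exact: ltW.
    have h2 := Rfun_mono xb A20 B20 (ltW tb1).
    by clear -h1 h2 s1b; lra.
  by clear -hF c02; lra.
rewrite lt_neqAle xr andbT; apply/eqP => xE.
have : w0 x t - m * om x t <= - eta0.
  by apply: ombig => //; rewrite -rE -xE; exact: Z0.
by clear -hF c02; lra.
Qed.

(** * The gradient bound *)

Lemma visc_sol_decrease (R : realType) n T (H : 'rV[R]_n -> R -> R -> 'rV[R]_n -> R)
    (C1 beta A2 B2 K3 : R) (HH : hamiltonian T H C1 beta A2 B2 K3)
    (u0 : 'rV[R]_n -> R) (u : 'rV[R]_n -> R -> R) (x0 xb : 'rV[R]_n) (r theta tb : R) :
  lipschitz_fun u0 -> 0 < theta ->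
  (forall x p, enorm (x - x0) < r -> subdiff u0 x p -> theta <= enorm p) ->
  visc_sol T H u0 u -> Eset T A2 B2 x0 r xb tb ->
  let b := theta * expR (- ((C1 + K3) * tb))
        - C1 * beta / (C1 + K3) * (1 - expR (- ((C1 + K3) * tb))) in
  0 < b -> exists2 a, 0 < a & forall rho0, 0 < rho0 -> rho0 <= a ->
    exists y, enorm (y - xb) <= rho0 * expR (C1 * tb) /\
      u y tb + rho0 * expR (C1 * tb) * b <= u xb tb.
Proof.
move=> Hu0 theta0 HU hu [_ [tT hE]] b b0.
have [tb0 tbT] := andP tT.
have C10 := ham_C1 HH; have be0 := ham_beta HH; have K30 := ham_K3 HH.
(* [G] is the room that the base of the cone leaves in the ball of (U): half of it widens the base,
   and a quarter bounds the radius [rho0] used in [initial_slope]. *)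
pose G := r - enorm (xb - x0) - Rfun A2 B2 xb tb.
have G0 : 0 < G by rewrite /G; clear -hE; lra.
exists (G / 4) => [|rho0 rho00 rhoG]; first by rewrite divr_gt0.
have [ucont ui _] := hu.
have cu : cts_on [set Q | 0 <= Q.2 < T] u by move=> x t; exact: ucont.
pose rho t := rho0 * expR (C1 * t).
have [||v [va vm cv]] := @ball_inf_exists R n T u rho cu.
- by move=> t; rewrite mulr_gt0 // expR_gt0.
- by move=> t e e0; exact: expR_mul_cts.
have hv := ball_inf_supersub HH rho00 cu (visc_sol_quadsub hu) va vm cv.
have [kap kap0 kapE] : exists2 kap, 0 <= kap & kap = C1 * beta / (C1 + K3).
  by eexists; last reflexivity; rewrite divr_ge0 ?mulr_ge0 ?addr_ge0.
(* In the degenerate case [C1 + K3 = 0] both sides vanish, since then [C1 = 0]; one formula thus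
   serves both parts of the theorem. *)
have kapM : kap * (C1 + K3) = C1 * beta.
  have [s0|s0] := eqVneq (C1 + K3) 0; last by rewrite kapE divfK.
  have c0 : C1 = 0 by clear -s0 C10 K30; lra.
  by rewrite s0 c0 mulr0 mul0r.
(* The claimed bound as a function of time; it solves [br' = - (C1 + K3) br - C1 beta] with
   [br 0 = theta], and [gE] identifies it with [g / rho]. *)
pose br t := (theta + kap) * expR (- (C1 + K3) * t) - kap.
have bE : b = br tb by rewrite /b /br -kapE mulNr; ring.
pose g t := rho0 * ((theta + kap) * expR (- K3 * t) + - kap * expR (C1 * t)).
pose g' t := rho0 * ((theta + kap) * (expR (- K3 * t) * - K3) + - kap * (expR (C1 * t) * C1)).
have gE t : g t = rho t * br t.
  rewrite /g /rho /br (_ : - (C1 + K3) * t = - (C1 * t) + - K3 * t); last by ring.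
  by rewrite expRD expRN; field; rewrite gt_eqF // expR_gt0.
(* Comparison runs to a time beyond [tb] and asks for [g >= 0] throughout; as [br] is nonincreasing
   and positive at [tb], a short extension is safe. *)
have [d d0 hd] := expR_mul_cts (- (C1 + K3)) (theta + kap) tb b0.
have [|h h0 /and3P[h1 h2 _]] := @exists_lbound _ [:: d / 2; (T - tb) / 2].
  by rewrite /= !divr_gt0 // subr_gt0.
have tk0 : 0 <= theta + kap by rewrite addr_ge0 // ltW.
have g0 t : 0 <= t <= tb + h -> 0 <= g t.
  move=> /andP[t0 t1]; rewrite gE mulr_ge0 ?mulr_ge0 ?expR_ge0 ?(ltW rho00) //.
  apply: (@le_trans _ _ (br (tb + h))).
    have := hd (tb + h); rewrite (addrC tb) addrK (gtr0_norm h0) => /(_ _).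
    have hh : h < d by clear -h1 d0; lra.
    move=> /(_ hh); rewrite ltr_norml /br (addrC h).
    by move: bE; rewrite /br; clear; lra.
  rewrite /br lerD2r ler_wpM2l // ler_expR !mulNr lerN2 ler_wpM2l //.
  exact: addr_ge0.
have hcmp : v xb tb + g tb <= u xb tb.
  apply: (comparison HH (t1 := tb + h) (rad := Rfun A2 B2 xb tb + G / 2) (g' := g')
    (c := fun t => C1 * beta * rho t) cu cv (visc_sol_quadsup hu) hv _ _ g0 tb0) => //.
  - move=> x t.
    have := fdiffM (fdiff_cst rho0 x t) (fdiffD
      (fdiffM (fdiff_cst (theta + kap) x t) (fdiff_expR (fdiff_time (- K3) x t)))
      (fdiffM (fdiff_cst (- kap) x t) (fdiff_expR (fdiff_time C1 x t)))).
    by rewrite !(scaler0, addr0, mulr0).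
  - move=> t; rewrite le_eqVlt; apply/orP; left; apply/eqP.
    rewrite /g' /g /rho -kapM; ring.
  - by rewrite ltrDl.
  - by clear -h2 h0 tbT; lra.
  - by rewrite ltrDl divr_gt0.
  move=> x hx; have t00 : 0 <= (0 : R) < T by rewrite lexx (lt_trans tb0).
  have xr : enorm (x - x0) + rho0 < r.
    have := enorm_dist x xb x0; move: hx rhoG G0; rewrite /G; clear; lra.
  have [y [hy uy]] := initial_slope Hu0 theta0 HU rho00 xr.
  have := vm x 0 y t00; rewrite /rho mulr0 expR0 mulr1 => /(_ hy).
  rewrite !ui gE /rho /br !mulr0 expR0 !mulr1; move: uy; clear; lra.
have t0T : 0 <= tb < T by rewrite (ltW tb0).
have [y [hy vy]] := va xb tb t0T; exists y; split=> //.
by rewrite -vy bE; have := gE tb; rewrite /rho => <-.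
Qed.

(** At time [t], [u] drops by [rho b] within distance [rho], while a test function below [u] with
    gradient [p] allows a drop of at most [(|p| + e) rho]. When [b] is not positive the bound is
    immediate. *)
Lemma visc_sol_gradient_ge (R : realType) n T (H : 'rV[R]_n -> R -> R -> 'rV[R]_n -> R)
    (C1 beta A2 B2 K3 : R) (HH : hamiltonian T H C1 beta A2 B2 K3)
    (u0 : 'rV[R]_n -> R) (u : 'rV[R]_n -> R -> R) (x0 x p : 'rV[R]_n) (r theta t : R) :
  lipschitz_fun u0 -> 0 < theta ->
  (forall x p, enorm (x - x0) < r -> subdiff u0 x p -> theta <= enorm p) ->
  visc_sol T H u0 u -> Eset T A2 B2 x0 r x t -> subdiff_x T u x t p ->
  theta * expR (- ((C1 + K3) * t))
        - C1 * beta / (C1 + K3) * (1 - expR (- ((C1 + K3) * t))) <= enorm p.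
Proof.
move=> Hu0 theta0 HU hu hE [tau [phi [Dx [Dt [hphi [-> [_ [d1 d10 hmin]]]]]]]].
set b := _ - _; have [b0|b0] := leP b 0; first exact: le_trans b0 (enorm_ge0 _).
have [a a0 ha] := visc_sol_decrease HH Hu0 theta0 HU hu hE b0.
have tT : 0 < t < T by case: hE => _ [].
apply/ler_addgt0Pr => e e0.
have [d2 d20 hd2] := hphi x t tT e e0.
pose E := expR (C1 * t); have E0 : 0 < E by exact: expR_gt0.
have [|c c0 /and4P[c1 c2 c3 _]] := @exists_lbound _ [:: a; d1 / 2 / E; d2 / 2 / E].
  by rewrite /= a0 !divr_gt0.
have [y [hy uy]] := ha c c0 c1.
rewrite -/E -/b in hy uy; set rho := c * E in hy uy.
have rho0 : 0 < rho by rewrite mulr_gt0.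
have r1 : rho < d1 by move: c2; rewrite ler_pdivlMr // -/rho; clear -d10; lra.
have r2 : rho < d2 by move: c3; rewrite ler_pdivlMr // -/rho; clear -d20; lra.
have tt0 (d : R) : 0 < d -> `|t - t| < d by rewrite subrr normr0.
have k1 := hmin y t tT (le_lt_trans hy r1) (tt0 _ d10).
have [k2 _ _] := hd2 y t tT (le_lt_trans hy r2) (tt0 _ d20).
move: k2; rewrite subrr normr0 mulr0 subr0 addr0 ler_norml => /andP[k2 _].
have k3 := dotv_ge (Dx x t) (y - x).
have k4 : (enorm (Dx x t) + e) * enorm (y - x) <= (enorm (Dx x t) + e) * rho.
  by rewrite ler_wpM2l // addr_ge0 // ltW.
rewrite -(ler_pM2l rho0); clear -uy k1 k2 k3 k4; lra.
Qed.

Theorem theorem1p5 (R : realType) (n : nat) (T : R) (hT : 0 < T) (hn : (1 <= n)%N)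
  (H : 'rV[R]_n -> R -> R -> 'rV[R]_n -> R) (u0 : 'rV[R]_n -> R)
  (C1 beta A2 B2 K3 : R) (x0 : 'rV[R]_n) (r theta : R)
  (HHc : H_cont T H)
  (Hu0 : lipschitz_fun u0)
  (HC1 : 0 <= C1) (Hbeta : beta = 0 \/ beta = 1)
  (H1 : forall x y t v p, 0 <= t <= T ->
     `|H x t v p - H y t v p| <= C1 * (beta + enorm p) * enorm (x - y))
  (HA2 : 0 <= A2) (HB2 : 0 <= B2)
  (H2 : forall x t v p q, 0 <= t <= T ->
     `|H x t v p - H x t v q| <= (A2 * enorm x + B2) * enorm (p - q))
  (HK3 : 0 <= K3)
  (H3 : forall x t v w p, 0 <= t <= T ->
     `|H x t v p - H x t w p| <= K3 * `|v - w|)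
  (H4 : forall x t v p q (l : R), 0 <= t <= T -> 0 <= l <= 1 ->
     H x t v (l *: p + (1 - l) *: q) <= l * H x t v p + (1 - l) * H x t v q)
  (hr : 0 < r) (htheta : 0 < theta)
  (HU : forall x p, enorm (x - x0) < r -> subdiff u0 x p -> theta <= enorm p)
  (u : 'rV[R]_n -> R -> R) (hu : visc_sol T H u0 u) :
  ((C1 != 0) || (K3 != 0) ->
    forall x t p, Eset T A2 B2 x0 r x t -> subdiff_x T u x t p ->
      theta * expR (- ((C1 + K3) * t))
        - C1 * beta / (C1 + K3) * (1 - expR (- ((C1 + K3) * t))) <= enorm p) /\
  ((C1 == 0) && (K3 == 0) ->
    forall x t p, Eset T A2 B2 x0 r x t -> subdiff_x T u x t p -> theta <= enorm p).
Proof.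
have HH : hamiltonian T H C1 beta A2 B2 K3.
  by split=> //; case: Hbeta => ->.
split=> [_|/andP[/eqP c0 /eqP k0]] x t p hE hp.
  exact: (visc_sol_gradient_ge HH Hu0 htheta HU hu hE hp).
have := visc_sol_gradient_ge HH Hu0 htheta HU hu hE hp.
by rewrite c0 k0 addr0 !mul0r oppr0 expR0 addr0 mulr1.
Qed.
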